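(* The topological complexity $\mathsf{TC}(X)$ of a random simplicial complex $X\subset\Delta_n$ in the medial regime satisfies $\mathsf{TC}(X)\le 2$ asymptotically almost surely (i.e. with probability tending to $1$ as $n\to\infty$).
   Context: Simplexes are non-empty. $\Delta_n$ is the simplex with vertex set $[n]=\{1,\dots,n\}$, whose simplexes are all non-empty subsets of $[n]$. Lower multi-parameter model: given numbers $p_\sigma\in[0,1]$ for each simplex $\sigma$ of $\Delta_n$ (they may depend on $n$), $\mathcal P$ is the unique probability measure on the set of all simplicial subcomplexes $X\subset\Delta_n$ (the vertex set of $X$ may be a proper subset of $[n]$) such that for every subcomplex $L\subset\Delta_n$ one has $\mathcal P\{X: L\subset X\}=\prod_{\sigma\in L}p_\sigma$. Medial regime: there are constants $0<p\le P<1$ independent of $n$ such that $p\le p_\sigma\le P$ for all $n$ and all simplexes $\sigma$ of $\Delta_n$. The (reduced) topological complexity $\mathsf{TC}(X)$ of a topological space $X$ is the minimal integer $k\ge0$ such that $X\times X$ admits an open cover $X\times X=U_0\cup U_1\cup\dots\cup U_k$ such that each inclusion $\mu_i:U_i\to X\times X$ satisfies $\mathrm{pr}_1\circ\mu_i\simeq\mathrm{pr}_2\circ\mu_i$ (homotopic maps $U_i\to X$), where $\mathrm{pr}_1,\mathrm{pr}_2:X\times X\to X$ are the projections; $\mathsf{TC}(X)=\infty$ if no such $k$ exists. For a simplicial complex it is taken of the geometric realisation. *)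

(* Defs.v *)
From HB Require Import structures.
From mathcomp Require Import all_boot all_order all_algebra.
From mathcomp Require Import all_classical all_reals all_analysis.

Set Implicit Arguments.
Unset Strict Implicit.
Unset Printing Implicit Defensive.

Import Order.TTheory GRing.Theory Num.Theory.
Import numFieldNormedType.Exports.

Local Open Scope classical_set_scope.
Local Open Scope ring_scope.

(* The vertex set is ['I_n]. A subcomplex is the set of its simplexes; it need
   not contain every vertex and may be empty. *)
Definition is_subcomplex (n : nat) (X : {set {set 'I_n}}) : bool :=
  [forall s in X, (s != finset.set0) &&
     [forall t : {set 'I_n},
        (t != finset.set0) && (t \subset s) ==> (t \in X)]].

Record subcomplex (n : nat) := Subcomplex {
  simplexes :> {set {set 'I_n}} ;
  subcomplexP : is_subcomplex simplexes }.

HB.instance Definition _ (n : nat) := [isSub for @simplexes n].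
HB.instance Definition _ (n : nat) := [Finite of subcomplex n by <:].

Lemma is_subcomplex0 (n : nat) : is_subcomplex (finset.set0 : {set {set 'I_n}}).
Proof. by apply/forall_inP => s; rewrite inE. Qed.

HB.instance Definition _ (n : nat) :=
  isPointed.Build (subcomplex n) (Subcomplex (is_subcomplex0 n)).

HB.instance Definition _ (n : nat) :=
  @isMeasurable.Build default_measure_display (subcomplex n)
    discrete_measurable discrete_measurable0
    discrete_measurableC discrete_measurableU.

(* At most one probability measure satisfies this, since the events
   [{X : L \subset X}] form a pi-system generating all events. *)
Definition is_lower_model (R : realType) (n : nat) (p : {set 'I_n} -> R)
    (mu : probability (subcomplex n) R) : Prop :=
  forall L : subcomplex n,
    mu [set X : subcomplex n | (L : {set _}) \subset (X : {set _})]
    = (\prod_(s in (L : {set {set 'I_n}})) p s)%:E.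

(* Barycentric coordinates; as a type, it carries the topology induced by the
   norm topology of ['rV[R]_n]. *)
Definition realisation (R : realType) (n : nat) (X : subcomplex n)
    : set 'rV[R]_n :=
  [set x | [/\ forall i, 0 <= x ord0 i,
               \sum_i x ord0 i = 1
             & [set i | x ord0 i != 0]%SET \in (X : {set {set 'I_n}})]].

Arguments realisation R {n} X.

(* [H] is only constrained on [A * [0, 1]]. *)
Definition homotopic (R : realType) (A B : topologicalType) (f g : A -> B)
    : Prop :=
  exists H : A * R -> B,
    [/\ {within [set: A] `*` `[0, 1], continuous H},
        forall a, H (a, 0) = f a
      & forall a, H (a, 1) = g a].

Definition TC_cover (R : realType) (X : topologicalType) (k : nat) : Prop :=
  exists U : 'I_k.+1 -> set (X * X),
    [/\ forall i, open (U i),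
        \bigcup_i U i = [set: X * X]
      & forall i, homotopic R (fun z : U i => (set_val z).1)
                              (fun z : U i => (set_val z).2)].

(* The infimum is a minimum when finite, and is [+oo] when no cover exists. *)
Definition TC (R : realType) (X : topologicalType) : \bar R :=
  ereal_inf [set k%:R%:E | k in TC_cover R X].

(* Main.v *)
Require Import Defs.
From HB Require Import structures.
From mathcomp Require Import all_boot all_order all_algebra.
From mathcomp Require Import zify ring lra.

(* A discrete homotopy theory shows that a random complex is highly connected.
   Order-reversing maps between families of finite sets, extended after finitely
   many barycentric subdivisions, give a combinatorial notion of connectivity for
   which a gluing lemma, hence a nerve lemma, is elementary.  If every subcomplex
   with at most N = 3^q simplices is contained in a cone, then X is
   (q - 1)-connected in this sense: cover by stars the complex of all s such that
   s :|: g is in X for every g in G; a k-fold intersection of these stars is the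
   complex of the same kind for the join of G with k points, of cardinal at most
   (k + 1) |G| <= 3^(k-1) |G| for k >= 2.

   In the lower model, with N a small multiple of ln n, asymptotically almost surely
   this cone property holds and no simplex has 2q + 1 vertices: the number of
   candidate subcomplexes is quasi-polynomial in n while each fails to be coned off
   with probability exp(- n^c), and 4^q exceeds N ln N.  Since 4 > 3, the faces with at most
   q vertices and those with more than q vertices both span, in the barycentric
   subdivision, complexes of dimension less than q, hence contractible in X.  Thus X
   is the union of two open sets contractible in X, and the usual product argument
   (cat X <= 1 implies TC X <= 2) concludes. *)

Set Implicit Arguments.
Unset Strict Implicit.
Unset Printing Implicit Defensive.

(** * Connectivity of finite complexes *)

Section Families.
Variable V : finType.
Implicit Types (K L : {set {set V}}) (a b c : {set V}) (C D : {set {set V}}).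

Definition chain C := [forall a in C, forall b in C, (a \subset b) || (b \subset a)].

Lemma chainP C :
  reflect {in C &, forall a b, (a \subset b) || (b \subset a)} (chain C).
Proof.
apply: (iffP forall_inP) => [h a b aC bC | h a aC].
  by have /forall_inP := h a aC; apply.
by apply/forall_inP => b bC; apply: h.
Qed.

Lemma chainS C D : C \subset D -> chain D -> chain C.
Proof.
by move=> /subsetP sub /chainP h; apply/chainP => a b /sub aD /sub bD; apply: h.
Qed.

(** The family is seen as a poset under inclusion: its order complex has dimension less than [h]. *)
Definition height K h := forall C, C \subset K -> chain C -> #|C| <= h.

Lemma heightS K L h : L \subset K -> height K h -> height L h.
Proof. by move=> LK hK C CL; apply: hK; apply: subset_trans LK. Qed.

Lemma chain_top C : chain C -> C != set0 ->
  exists2 a, a \in C & {in C, forall b, b \subset a}.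
Proof.
move=> /chainP ch /set0Pn [a0 a0C].
case: (@arg_maxnP _ a0 (mem C) (fun a => #|a|)) => //= a aC amax.
exists a => // b bC; case/orP: (ch a b aC bC) => // ab.
have /eqP <- : a == b by rewrite eqEcard ab amax.
by [].
Qed.

Lemma chain_bottom C : chain C -> C != set0 ->
  exists2 a, a \in C & {in C, forall b, a \subset b}.
Proof.
move=> /chainP ch /set0Pn [a0 a0C].
case: (@arg_minnP _ a0 (mem C) (fun a => #|a|)) => //= a aC amin.
exists a => // b bC; case/orP: (ch a b aC bC) => // ba.
have /eqP <- : b == a by rewrite eqEcard ba amin.
by [].
Qed.

(** A member of a chain is determined by its cardinal, and only [k] cardinals are allowed. *)
Lemma card_chain C m k :
  chain C -> {in C, forall a, m < #|a| <= m + k} -> #|C| <= k.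
Proof.
move=> /chainP ch bnd; have [->|[a0 a0C]] := set_0Vmem C; first by rewrite cards0.
case: k bnd => [|k] bnd; first by have := bnd a0 a0C; lia.
have inj : {in C &, injective (fun a => inord (#|a| - m.+1) : 'I_k.+1)}.
  move=> a b aC bC /(congr1 val); have := bnd a aC; have := bnd b bC.
  move=> hb ha; rewrite /= !inordK; [|lia|lia] => e.
  have eab : #|a| = #|b| by lia.
  case/orP: (ch a b aC bC) => s; apply/eqP; first by rewrite eqEcard s eab leqnn.
  by rewrite eq_sym eqEcard s eab leqnn.
by rewrite -(card_in_imset inj); apply: leq_trans (max_card _) _; rewrite card_ord.
Qed.

(** The order complex of the family; for a simplicial complex, its barycentric subdivision. *)
Definition sd K : {set {set {set V}}} :=
  [set C : {set {set V}} | [&& C \subset K, C != set0 & chain C]].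

Lemma sdP K C : reflect [/\ C \subset K, C != set0 & chain C] (C \in sd K).
Proof. by rewrite inE; apply: (iffP and3P). Qed.

Lemma sdS K L : L \subset K -> sd L \subset sd K.
Proof.
move=> LK; apply/subsetP => C /sdP [CL C0 ch]; apply/sdP; split=> //.
exact: subset_trans LK.
Qed.

Lemma sdI K L : sd (K :&: L) = sd K :&: sd L.
Proof.
apply/setP => C; rewrite !inE subsetI.
by case: (C \subset K); case: (C \subset L); case: (C != set0); case: (chain C).
Qed.

End Families.

Lemma sd_height (V : finType) (K : {set {set V}}) h : height K h -> height (sd K) h.
Proof.
move=> hK C CK ch; apply: (@card_chain _ _ 0) => // a /(subsetP CK) /sdP [aK a0 ca].
by rewrite card_gt0 a0 /= add0n hK.
Qed.

Definition face_closed (V : finType) (K : {set {set V}}) :=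
  forall a b : {set V}, b \in K -> a \subset b -> a != set0 -> a \in K.

Lemma sd_closed (V : finType) (K : {set {set V}}) : face_closed (sd K).
Proof.
move=> a b /sdP [bK _ ch] ab a0; apply/sdP; split=> //.
  exact: subset_trans bK.
exact: chainS ch.
Qed.

(** The largest member of a chain lies in [K] or in [L], and closure under faces puts the whole
    chain there. *)
Lemma sdU (V : finType) (K L : {set {set V}}) :
  set0 \notin K :|: L -> face_closed K -> face_closed L -> sd (K :|: L) = sd K :|: sd L.
Proof.
move=> n0 cK cL; apply/eqP; rewrite eqEsubset; apply/andP; split; last first.
  by rewrite subUset !sdS // ?subsetUl ?subsetUr.
apply/subsetP => C /sdP [CKL C0 ch].
have ne a : a \in C -> a != set0.
  by move=> /(subsetP CKL) aK; apply: contraNneq n0 => <-.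
have [a aC atop] := chain_top ch C0.
rewrite inE; apply/orP.
have /setUP [aK|aL] := subsetP CKL a aC; [left|right]; apply/sdP; split=> //;
  apply/subsetP => b bC.
- by apply: cK aK (atop b bC) (ne b bC).
- by apply: cL aL (atop b bC) (ne b bC).
Qed.

Lemma set0_sd (V : finType) (K : {set {set V}}) : set0 \notin sd K.
Proof. by apply/negP => /sdP []; rewrite eqxx. Qed.

(** * Order-reversing maps and their extension after subdivision *)

Definition amap (V W : finType) (K : {set {set V}}) (Y : {set {set W}})
    (f : {set V} -> {set W}) :=
  {in K, forall a : {set V}, f a \in Y} /\ {in K &, forall a b : {set V}, a \subset b -> f b \subset f a}.

(* On a chain of a family on which [f] is antitone this is the value of [f] at
   the largest member of the chain. *)
Definition pull (V W : finType) (f : {set V} -> {set W}) (C : {set {set V}}) : {set W} :=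
  \bigcap_(a in C) f a.

Lemma pull_anti (V W : finType) (f : {set V} -> {set W}) (C D : {set {set V}}) :
  C \subset D -> pull f D \subset pull f C.
Proof.
by move=> /subsetP CD; apply/bigcapsP => a aC; apply: bigcap_inf; apply: CD.
Qed.

Lemma pull_sub (V W : finType) (f : {set V} -> {set W}) (C : {set {set V}}) a :
  a \in C -> pull f C \subset f a.
Proof. by move=> aC; apply: bigcap_inf. Qed.

Lemma pull_top (V W : finType) (K : {set {set V}}) (Y : {set {set W}}) f C :
  amap K Y f -> C \in sd K -> exists2 a, a \in C & pull f C = f a.
Proof.
move=> [_ anti] /sdP [CK C0 ch]; have [a aC top] := chain_top ch C0.
exists a => //; apply/eqP; rewrite eqEsubset pull_sub //=.
by apply/bigcapsP => b bC; apply: anti; rewrite ?(subsetP CK) ?top.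
Qed.

Lemma eq_pull (V W : finType) (K : {set {set V}}) (f g : {set V} -> {set W}) :
  {in K, f =1 g} -> {in sd K, pull f =1 pull g}.
Proof.
move=> fg C /sdP [/subsetP CK _ _].
by apply: eq_bigr => a aC; apply: fg; apply: CK.
Qed.

(** Intersections over larger chains are smaller, and over a chain they are values of [f]; hence the
    construction can be iterated. *)
Lemma amap_pull (V W : finType) (K : {set {set V}}) (Y : {set {set W}}) f :
  amap K Y f -> amap (sd K) Y (pull f).
Proof.
move=> fK; split=> [C CK|C D _ _]; last exact: pull_anti.
have [a aC ->] := pull_top fK CK; case: fK => + _; apply.
by move/sdP: CK => [/subsetP CK _ _]; apply: CK.
Qed.

(* After [m] barycentric subdivisions [f] extends from [L] to [K]. *)
Fixpoint ext (W : finType) (Y : {set {set W}}) (m : nat) (V : finType)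
    (K L : {set {set V}}) (f : {set V} -> {set W}) : Prop :=
  if m is m'.+1 then ext Y m' (sd K) (sd L) (pull f)
  else exists2 g, amap K Y g & {in L, g =1 f}.

(* [Y] is (h - 2)-connected: the families [K] have dimension less than [h]. *)
Definition conn (W : finType) (Y : {set {set W}}) (h : nat) : Prop :=
  forall (V : finType) (K L : {set {set V}}) (f : {set V} -> {set W}),
    L \subset K -> height K h -> amap L Y f -> exists m, ext Y m K L f.

Section Ext.
Variables (W : finType) (Y : {set {set W}}).

Lemma extS m (V : finType) (K L : {set {set V}}) f :
  L \subset K -> ext Y m K L f -> ext Y m.+1 K L f.
Proof.
elim: m V K L f => [|m IH] V K L f LK.
  move=> [g gK gL]; exists (pull g); first exact: amap_pull.
  exact: eq_pull.
by move=> e; apply: (IH _ (sd K) (sd L)) => //; apply: sdS.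
Qed.

Lemma ext_leq m m' (V : finType) (K L : {set {set V}}) f :
  L \subset K -> m <= m' -> ext Y m K L f -> ext Y m' K L f.
Proof.
move=> LK mm' e; rewrite -(subnK mm'); elim: (m' - m) => // k IH.
by rewrite addSn; apply: extS.
Qed.

End Ext.

Lemma conn0 (W : finType) (Y : {set {set W}}) : conn Y 0.
Proof.
move=> V K L f LK hK [fL _]; exists 0 => /=.
have K0 : K = set0.
  apply/setP => a; rewrite inE; apply/negP => aK.
  have := hK [set a]; rewrite sub1set cards1 => /(_ aK).
  suff -> : chain [set a] by move/(_ isT).
  by apply/chainP => ? ? /set1P -> /set1P ->; rewrite subxx.
exists f => // ; split=> a; rewrite K0 inE //.
Qed.

(** Height 1 excludes strict inclusions, so all missing values may be set to [s]. *)
Lemma conn1 (W : finType) (Y : {set {set W}}) (s : {set W}) : s \in Y -> conn Y 1.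
Proof.
move=> sY V K L f LK hK [fL _]; exists 0 => /=.
exists (fun a => if a \in L then f a else s) => [|a ->] //.
split=> [a _|a b aK bK ab]; first by case: ifP => // /fL.
suff -> : a = b by [].
apply/eqP; apply/idPn => nab.
have := hK [set a; b]; rewrite subUset !sub1set aK bK cards2 nab => /(_ isT).
suff -> : chain [set a; b] by move/(_ isT).
by apply/chainP => ? ? /set2P [] -> /set2P [] ->; rewrite ?subxx ?ab ?orbT.
Qed.

Lemma cone_conn (W : finType) (Y : {set {set W}}) (w : W) h :
  face_closed Y -> set0 \notin Y -> [set w] \in Y ->
  {in Y, forall s, w |: s \in Y} -> conn Y h.
Proof.
move=> cY Y0 wY coneY V K L f LK hK fL; exists 2.
(* The zigzag of [f], [w |: f], [w] on the simplexes inside, across and outside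
   [L] is not monotone, but becomes so after one more subdivision. *)
pose l (c : {set {set V}}) : {set W} :=
  if c :&: L == set0 then [set w]
  else if c \subset L then pull f c else w |: pull f (c :&: L).
have sdL c : c \in sd K -> c :&: L != set0 -> c :&: L \in sd L.
  move=> /sdP [cK _ ch] c0; apply/sdP; split=> //; first exact: subsetIr.
  by apply: chainS ch; apply: subsetIl.
have lY c : c \in sd K -> l c \in Y.
  move=> cK; rewrite /l; case: ifP => // /negbT c0; case: ifP => cL; last first.
    by apply: coneY; apply: (amap_pull fL).1; apply: sdL.
  apply: (amap_pull fL).1; move: (sdL _ cK c0).
  by have /setIidPl -> := cL.
have lL : {in sd L, l =1 pull f}.
  move=> c /sdP [cL c0 _]; rewrite /l cL.
  by move/setIidPl: (cL) => ->; rewrite (negPf c0).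
rewrite /=; exists (pull l); last exact: eq_pull.
split=> [C CK|C D _ _]; last exact: pull_anti.
have [/subsetP CsK C0 chC] := sdP _ _ CK.
have [d dC dtop] := chain_top chC C0.
(* The value at [C] is a subset of the face [l d], so only its non-emptiness remains; the smallest
   member [c] of [C] decides which point witnesses it. *)
apply: cY (pull_sub _ dC) _; first by apply: lY; apply: CsK.
have dK := CsK d dC.
have [c cC cbot] := chain_bottom chC C0.
have cK := CsK c cC.
have [c0|cL] := boolP (c :&: L == set0).
  (* No member of [C] is contained in [L], since it contains [c]; hence the apex lies in every
     value. *)
  apply/set0Pn; exists w; apply/bigcapP => e eC; rewrite /l.
  case: ifP => e0; first by rewrite set11.
  case: ifP => eL; last by rewrite setU11.
  move: c0; have : c \subset L by apply: subset_trans (cbot e eC) eL.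
  move/setIidPl => -> /eqP c0; move/sdP: cK => []; by rewrite c0 eqxx.
have cdL : d :&: L != set0.
  apply: contraNneq cL => dL; rewrite -subset0 -dL; apply: setSI; exact: cbot.
(* Every member of [C] now meets [L], and a point of the value at the largest trace [d :&: L]
   belongs to all the others. *)
have : pull f (d :&: L) \in Y by apply: (amap_pull fL).1; apply: sdL.
move=> pY; have : pull f (d :&: L) != set0 by apply: contraNneq Y0 => <-.
case/set0Pn=> x xp; apply/set0Pn; exists x; apply/bigcapP => e eC.
have ceL : e :&: L != set0.
  apply: contraNneq cL => dL; rewrite -subset0 -dL; apply: setSI; exact: cbot.
have xe : x \in pull f (e :&: L).
  by apply: (subsetP (pull_anti f _) x xp); apply: setSI; apply: dtop.
rewrite /l (negPf ceL); case: ifP => eL; first by move/setIidPl: eL xe => ->.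
by rewrite inE xe orbT.
Qed.

(** * Gluing extensions over a union *)

Section Glue.
Variables (W : finType) (A B : {set {set W}}).

(** Subdivision commutes with the unions and intersections involved, which reduces to [m = 0]; there
    the two extensions agree on the overlap because it lies in both [LA] and [LB]. *)
Lemma ext_glue m (V : finType) (K KA KB LA LB L : {set {set V}}) fA fB f :
  K = KA :|: KB -> set0 \notin K -> face_closed KA -> face_closed KB ->
  KA :&: KB \subset LA -> KA :&: KB \subset LB -> {in KA :&: KB, fA =1 fB} ->
  L \subset K ->
  L :&: KA \subset LA -> {in L :&: KA, fA =1 f} ->
  L :&: KB \subset LB -> {in L :&: KB, fB =1 f} ->
  ext A m KA LA fA -> ext B m KB LB fB -> ext (A :|: B) m K L f.
Proof.
elim: m V K KA KB LA LB L fA fB f => [|m IH] V K KA KB LA LB L fA fB f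
  EK K0 cA cB MA MB fAB LK LAs fAf LBs fBf /=; last first.
  apply: (IH _ _ (sd KA) (sd KB)) => //; rewrite -?sdI; try exact: sdS;
    try exact: eq_pull; try exact: sd_closed; try exact: set0_sd.
  by rewrite EK sdU -?EK.
move=> [gA [gAY gAa] gAf] [gB [gBY gBa] gBf].
have gAB a : a \in KA -> a \in KB -> gA a = gB a.
  move=> aA aB; have aM : a \in KA :&: KB by rewrite inE aA.
  by rewrite gAf ?(subsetP MA) // gBf ?(subsetP MB) // fAB.
exists (fun a => if a \in KA then gA a else gB a).
  split=> [a|a b].
    rewrite EK !inE; case: ifP => [aA _|_ /= aB]; first by rewrite gAY.
    by rewrite gBY ?orbT.
  move=> aK bK ab.
  have a0 : a != set0 by apply: contraNneq K0 => <-.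
  have [bA|bA] := boolP (b \in KA).
    by rewrite (cA _ _ bA ab a0) gAa // (cA _ _ bA ab a0).
  have bB : b \in KB by move: bK; rewrite EK inE (negPf bA).
  have aB := cB _ _ bB ab a0.
  by case: ifP => [aA|_]; rewrite ?gAB // gBa.
move=> a aL; have := subsetP LK a aL; rewrite EK inE; case: ifP => [aA _|_ /= aB].
  by rewrite gAf ?(subsetP LAs) ?fAf ?inE ?aA ?aL.
by rewrite gBf ?(subsetP LBs) ?fBf ?inE ?aB ?aL.
Qed.

(** Once the map is extended over the overlap with values in [A :&: B], the connectivity of [A] and
    of [B] extends it separately over [KA] and [KB], relative to the overlap. *)
Lemma ext_cover h m (V : finType) (K KA KB L : {set {set V}}) f :
  conn A h -> conn B h -> height K h ->
  K = KA :|: KB -> set0 \notin K -> face_closed KA -> face_closed KB ->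
  L \subset K -> face_closed L ->
  amap (L :&: KA) A f -> amap (L :&: KB) B f ->
  ext (A :&: B) m (KA :&: KB) (L :&: (KA :&: KB)) f ->
  exists m', ext (A :|: B) m' K L f.
Proof.
move=> hA hB; elim: m V K KA KB L f => [|m IH] V K KA KB L f hK EK K0 cA cB LK cL
  fA fB /=; last first.
  rewrite !sdI => e.
  have [] := IH _ (sd K) (sd KA) (sd KB) (sd L) (pull f) => //.
  - exact: sd_height.
  - by rewrite EK sdU -?EK.
  - exact: set0_sd.
  - exact: sd_closed.
  - exact: sd_closed.
  - exact: sdS.
  - exact: sd_closed.
  - by rewrite -sdI; apply: amap_pull.
  - by rewrite -sdI; apply: amap_pull.
  - by move=> m' ?; exists m'.+1.
move=> [g [gY ga] gf]; set M := KA :&: KB in g gY ga gf *.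
have closM (a b : {set V}) : b \in M -> a \subset b -> a != set0 -> a \in M.
  by move=> /setIP [bA bB] ab a0; rewrite inE (cA _ _ bA) // (cB _ _ bB).
pose F a := if a \in M then g a else f a.
have FM : {in M, F =1 g} by move=> a aM; rewrite /F aM.
have FL : {in L, F =1 f}.
  by move=> a aL; rewrite /F; case: ifP => // aM; rewrite gf // inE aL aM.
have FD (D : {set {set W}}) (KD : {set {set V}}) :
    M \subset KD -> KD \subset K -> face_closed KD ->
    A :&: B \subset D -> amap (L :&: KD) D f -> amap (M :|: L :&: KD) D F.
  move=> MD DK cD ABD [fY fa]; split=> [a /setUP [aM|aL]|a b].
  - by rewrite FM // (subsetP ABD) ?gY.
  - by rewrite FL ?fY //; case/setIP: aL.
  move=> aU bU ab.
  have a0 : a != set0.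
    apply: contraNneq K0 => <-; apply: (subsetP DK).
    by case/setUP: aU => [/(subsetP MD) //|/setIP []].
  have [bM|bM] := boolP (b \in M).
    by have aM := closM _ _ bM ab a0; rewrite !FM // ga.
  have bL : b \in L :&: KD by move: bU; rewrite inE (negPf bM).
  have [bL' bD] := setIP bL.
  have aL := cL _ _ bL' ab a0.
  by rewrite !FL // fa // inE aL (cD _ _ bD).
have [mA eA] : exists m, ext A m KA (M :|: L :&: KA) F.
  apply: hA.
  - by rewrite subUset subsetIr subsetIl.
  - by apply: heightS hK; rewrite EK subsetUl.
  - by apply: FD; rewrite ?subsetIl // EK subsetUl.
have [mB eB] : exists m, ext B m KB (M :|: L :&: KB) F.
  apply: hB.
  - by rewrite subUset !subsetIr.
  - by apply: heightS hK; rewrite EK subsetUr.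
  - by apply: FD; rewrite ?subsetIr // EK subsetUr.
exists (maxn mA mB); apply: (ext_glue EK K0 cA cB (LA := M :|: L :&: KA)
   (LB := M :|: L :&: KB) (fA := F) (fB := F)) => //.
- exact: subsetUl.
- exact: subsetUl.
- exact: subsetUr.
- by move=> a /setIP [/FL].
- exact: subsetUr.
- by move=> a /setIP [/FL].
- by apply: ext_leq eA; rewrite ?leq_maxl // subUset subsetIl subsetIr.
- by apply: ext_leq eB; rewrite ?leq_maxr // subUset !subsetIr.
Qed.

(** The combinatorial counterpart of van Kampen and Mayer-Vietoris: the source is cut along an
    overlap of one dimension less, over which the map is first extended into [A :&: B]. *)
Lemma connU h :
  face_closed A -> face_closed B -> set0 \notin A :|: B ->
  conn A h -> conn B h -> conn (A :&: B) h.-1 -> conn (A :|: B) h.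
Proof.
case: h => [|h] cA cB n0 hA hB hM; first exact: conn0.
move=> V K L f LK hK fL.
(* A simplex of the subdivision with vertices of both kinds has at least two
   vertices, so these simplices have one dimension less; those of them that lie
   in [L] are sent to [A :&: B], because [f] is antitone. *)
pose al a := (a \in L) && (f a \notin B).
pose KA := [set C in sd K | [exists a in C, al a]].
pose KB := [set C in sd K | [exists a in C, ~~ al a]].
have KAP C : reflect (C \in sd K /\ exists2 a, a \in C & al a) (C \in KA).
  by rewrite [X in reflect _ X]inE; apply: (iffP andP) => -[-> /exists_inP].
have KBP C : reflect (C \in sd K /\ exists2 a, a \in C & ~~ al a) (C \in KB).
  by rewrite [X in reflect _ X]inE; apply: (iffP andP) => -[-> /exists_inP].
have KAs : KA \subset sd K by apply/subsetP => C /KAP [].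
have KBs : KB \subset sd K by apply/subsetP => C /KBP [].
have fY C : C \in sd L -> pull f C \in A :|: B by apply: (amap_pull fL).1.
have f0 C : C \in sd L -> pull f C != set0.
  by move=> /fY CY; apply: contraNneq n0 => <-.
have LA C : C \in sd L -> C \in KA -> pull f C \in A.
  move=> CL /KAP [_ [a aC /andP [aL aB]]].
  apply: cA (pull_sub f aC) (f0 _ CL).
  by have := fL.1 a aL; rewrite inE (negPf aB) orbF.
have LB C : C \in sd L -> C \in KB -> pull f C \in B.
  move=> CL /KBP [_ [a aC]]; have [/subsetP CsL _ _] := sdP _ _ CL.
  rewrite /al CsL // negbK => aB; exact: cB (pull_sub f aC) (f0 _ CL).
have fA : amap (sd L :&: KA) A (pull f).
  by split=> [C /setIP [? ?]|C D _ _ /pull_anti]; [apply: LA|].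
have fB : amap (sd L :&: KB) B (pull f).
  by split=> [C /setIP [? ?]|C D _ _ /pull_anti]; [apply: LB|].
have [m] : exists m, ext (A :&: B) m (KA :&: KB) (sd L :&: (KA :&: KB)) (pull f).
  apply: hM; first exact: subsetIr.
    move=> C /subsetP CM ch; apply: (@card_chain _ _ 1) => // c /CM /setIP [].
    move=> /KAP [/sdP [cK _ chc] [a ac aal]] /KBP [_ [b bc bal]].
    apply/andP; split; last by rewrite add1n; apply: hK.
    have nba : b != a by apply: contraNneq bal => ->.
    by rewrite (cardsD1 a) ac (cardsD1 b) !inE bc nba.
  split=> [C /setIP [CL /setIP [? ?]]|C D _ _ /pull_anti //].
  by rewrite inE LA ?LB.
(* [KA] and [KB] cover [sd K] but are closed upwards in it, not under faces; one more subdivision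
   replaces them by their order complexes, which are closed under faces. *)
move=> /(extS (subsetIr _ _)) /=; rewrite !sdI => e.
have [] := @ext_cover h.+1 m _ (sd (sd K)) (sd KA) (sd KB) (sd (sd L)) (pull (pull f)) => //.
- by apply: sd_height; apply: sd_height.
- apply/eqP; rewrite eqEsubset; apply/andP; split; last first.
    by rewrite subUset !sdS.
  apply/subsetP => C /sdP [/subsetP CK C0 ch].
  (* An element of the smallest simplex belongs to all the larger ones, so its kind puts the whole
     chain in one of the two parts. *)
  have [c cC cbot] := chain_bottom ch C0.
  have /sdP [_ /set0Pn [a ac] _] := CK c cC.
  rewrite inE; apply/orP.
  have [aal|aal] := boolP (al a); [left|right]; apply/sdP; split=> //;
    apply/subsetP => d dC; [apply/KAP|apply/KBP]; (split; first exact: CK);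
    by exists a => //; apply: (subsetP (cbot d dC)).
- exact: set0_sd.
- exact: sd_closed.
- exact: sd_closed.
- by apply: sdS; apply: sdS.
- exact: sd_closed.
- by rewrite -sdI; apply: amap_pull.
- by rewrite -sdI; apply: amap_pull.
- by move=> m' ?; exists m'.+2.
Qed.

End Glue.

Lemma face_closedI (V : finType) (K L : {set {set V}}) :
  face_closed K -> face_closed L -> face_closed (K :&: L).
Proof. by move=> cK cL a b /setIP [bK bL] ab a0; rewrite inE (cK _ _ bK) ?(cL _ _ bL). Qed.

Lemma face_closedU (V : finType) (K L : {set {set V}}) :
  face_closed K -> face_closed L -> face_closed (K :|: L).
Proof.
move=> cK cL a b /setUP [bK|bL] ab a0; rewrite inE; first by rewrite (cK _ _ bK).
by rewrite (cL _ _ bL) ?orbT.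
Qed.

(* The nerve lemma, for a cover whose nerve is a full simplex. *)
Lemma conn_nerve (W J : finType) (A : J -> {set {set W}}) (s : seq J) h :
  s != [::] -> (forall j, face_closed (A j)) -> (forall j, set0 \notin A j) ->
  (forall t : seq J, t != [::] -> {subset t <= s} ->
     conn (\bigcap_(j <- t) A j) (h.+1 - size t)) ->
  conn (\bigcup_(j <- s) A j) h.
Proof.
elim: s A h => // i s IH A h _ cA A0 hA.
have n0 t : set0 \notin \bigcup_(j <- t) A j.
  elim: t => [|j t IHt]; first by rewrite big_nil inE.
  by rewrite big_cons inE negb_or A0.
have hi : conn (A i) h.
  have := hA [:: i]; rewrite big_seq1 subn1; apply=> // j.
  by rewrite !inE => ->.
have [->|s0] := eqVneq s [::]; first by rewrite big_seq1.
have cl t : face_closed (\bigcup_(j <- t) A j).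
  elim: t => [|j t IHt]; first by move=> a b; rewrite big_nil inE.
  by rewrite big_cons; apply: face_closedU.
rewrite big_cons; apply: connU; rewrite // ?inE ?negb_or ?A0 ?n0 //.
  by apply: IH => // t t0 ts; apply: hA => // j /ts js; rewrite inE js orbT.
(* The overlap is covered by a family of the same type, to which the induction applies with
   [h.-1]. *)
have -> : A i :&: \bigcup_(j <- s) A j = \bigcup_(j <- s) (A i :&: A j).
  elim: (s) => [|j t IHt]; first by rewrite !big_nil setI0.
  by rewrite !big_cons setIUr IHt.
have [->|hpos] := posnP h; first exact: conn0.
apply: IH => // [j|j|t t0 ts].
- exact: face_closedI.
- by rewrite inE (negPf (A0 i)).
(* A subfamily [t] of the new cover is [i :: t] in the old one; the extra member pays for the drop
   from [h] to [h.-1]. *)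
- have -> : \bigcap_(j <- t) (A i :&: A j) = \bigcap_(j <- i :: t) A j.
    rewrite big_cons; elim: t t0 {ts} => // j t IHt _.
    rewrite !big_cons; have [->|t0] := eqVneq t [::].
      by rewrite !big_nil !setIT.
    by rewrite IHt // setIACA setIid.
  rewrite prednK //.
  have := hA (i :: t); rewrite /= subSS; apply=> // j.
  by rewrite !inE => /orP [->|/ts ->]; rewrite ?orbT.
Qed.

(** * Complexes in which every small subcomplex can be coned off *)

Section Conic.
Variables (W : finType) (X : {set {set W}}).
Hypotheses (cX : face_closed X) (X0 : set0 \notin X).
Implicit Types (G : {set {set W}}).

(** A simplicial complex together with its empty face, so that coning it off also provides the
    apex. *)
Definition down_closed G :=
  set0 \in G /\ forall a b : {set W}, b \in G -> a \subset b -> a \in G.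

Definition conic N := forall G, down_closed G -> G :\ set0 \subset X -> #|G| <= N ->
  exists w, {in G, forall g, w |: g \in X}.

(** The intersection of the closed stars of the members of [G], the star of the empty face being
    [X]. *)
Definition common_star G : {set {set W}} :=
  [set s | (s != set0) && [forall g in G, s :|: g \in X]].

Lemma common_starP G s :
  reflect (s != set0 /\ {in G, forall g, s :|: g \in X}) (s \in common_star G).
Proof. by rewrite inE; apply: (iffP andP) => -[-> /forall_inP]. Qed.

Lemma common_star_closed G : face_closed (common_star G).
Proof.
move=> a b /common_starP [_ h] ab a0; apply/common_starP; split=> // g gG.
apply: cX (h g gG) _ _; first exact: setSU.
by apply: contraNneq a0 => /eqP; rewrite setU_eq0 => /andP [/eqP ->].
Qed.

Lemma set0_common_star G : set0 \notin common_star G.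
Proof. by apply/negP => /common_starP []; rewrite eqxx. Qed.

(** [None] contributes [G] itself and [Some v] the cone with apex [v]. *)
Definition join_points (t : seq W) G : {set {set W}} :=
  \bigcup_(x <- None :: map Some t) [set (if x is Some v then v |: g else g) | g in G].

Lemma join_pointsP t G s :
  reflect (s \in G \/ exists2 v, v \in t & exists2 g, g \in G & s = v |: g)
    (s \in join_points t G).
Proof.
rewrite /join_points big_cons big_map inE.
apply: (iffP orP) => -[].
- by case/imsetP=> g gG ->; left.
- elim: t => [|v t IH]; first by rewrite big_nil inE.
  rewrite big_cons => /setUP [/imsetP [g gG ->]|/IH []].
  + by right; exists v; rewrite ?mem_head //; exists g.
  + by left.
  + by case=> u ut [g gG ->]; right; exists u; rewrite ?inE ?ut ?orbT //; exists g.
- by move=> sG; left; apply/imsetP; exists s.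
- move=> [v vt [g gG ->]]; right.
  elim: t vt => // u t IH; rewrite big_cons !inE => /orP [/eqP <-|/IH ->].
    by rewrite imset_f.
  by rewrite orbT.
Qed.

Lemma card_join_points t G : #|join_points t G| <= (size t).+1 * #|G|.
Proof.
rewrite /join_points mulSn big_cons big_map.
apply: leq_trans (leq_card_setU _ _) _; apply: leq_add; first exact: leq_imset_card.
elim: t => [|v t IH]; first by rewrite big_nil cards0.
rewrite big_cons mulSn; apply: leq_trans (leq_card_setU _ _) _.
by apply: leq_add IH; apply: leq_imset_card.
Qed.

Lemma join_points_down_closed t G : down_closed G -> down_closed (join_points t G).
Proof.
move=> [G0 cG]; split; first by apply/join_pointsP; left.
move=> a b /join_pointsP [bG|[v vt [g gG ->]]] ab; apply/join_pointsP.
  by left; apply: cG bG ab.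
have [va|va] := boolP (v \in a).
  right; exists v => //; exists (a :\ v); last by rewrite setD1K.
  by apply: cG gG _; rewrite subDset.
left; apply: cG gG _; apply/subsetP => x xa.
by have := subsetP ab x xa; rewrite !inE => /orP [/eqP e|//]; rewrite -e xa in va.
Qed.

(** The exponent is a budget: each further degree of connectivity costs a factor 3 in the size of
    the subcomplexes to be coned off. *)
Lemma common_star_conn N h G :
  conic N -> down_closed G -> G :\ set0 \subset X -> #|G| * 3 ^ h.-1 <= N ->
  conn (common_star G) h.
Proof.
move=> cone; have [n] := ubnP h; elim: n h G => // n IH h G.
rewrite ltnS => hn G0 GX GN; have [->|hpos] := posnP h; first exact: conn0.
have cardG : #|G| <= N by apply: leq_trans GN; rewrite leq_pmulr // expn_gt0.
have [w wG] := cone G G0 GX cardG.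
have ne v : [set v] != set0 :> {set W} by rewrite -card_gt0 cards1.
have wS : [set w] \in common_star G by apply/common_starP; split.
case: h hpos hn GN => // -[|h] _ hn GN; first exact: conn1 wS.
pose s := enum [set v | [set v] \in common_star G].
have memsE v : (v \in s) = ([set v] \in common_star G) by rewrite mem_enum inE.
have jX t : {subset t <= s} -> join_points t G :\ set0 \subset X.
  move=> ts; apply/subsetP => a /setD1P [a0 /join_pointsP [aG|[v vt [g gG ->]]]].
    by apply: (subsetP GX); rewrite !inE a0.
  by move: (ts v vt); rewrite memsE => /common_starP [_]; apply.
(* The stars of its vertices cover the complex, and joining [v] to [G] describes the star of [v]. *)
have -> : common_star G = \bigcup_(v <- s) common_star (join_points [:: v] G).
  apply/setP => a; apply/idP/idP.
    move=> /common_starP [a0 aG]; have /set0Pn [v va] := a0.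
    have vs : v \in s.
      rewrite memsE; apply: common_star_closed (introT (common_starP _ _) (conj a0 aG)) _ _ => //.
      by rewrite sub1set.
    suff : a \in common_star (join_points [:: v] G).
      elim: (s) vs => // u t IHt; rewrite big_cons in_cons in_setU.
      by move=> /orP [/eqP ->|vt] h0; [rewrite h0 | rewrite IHt // orbT].
    apply/common_starP; split=> // g /join_pointsP [/aG //|[u]].
    rewrite inE => /eqP -> [g' g'G ->].
    rewrite setUA (_ : a :|: [set v] = a) ?aG //.
    by apply/setUidPl; rewrite sub1set.
  elim: (s) => [|u t IHt]; first by rewrite big_nil inE.
  rewrite big_cons => /setUP [|/IHt //].
  move=> /common_starP [a0 h0]; apply/common_starP; split=> // g gG.
  by apply: h0; apply/join_pointsP; left.
apply: conn_nerve.
- have : w \in s by rewrite memsE.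
  by case: (s).
- by move=> v; apply: common_star_closed.
- by move=> v; apply: set0_common_star.
move=> t t0 ts.
have -> : \bigcap_(v <- t) common_star (join_points [:: v] G) =
          common_star (join_points t G).
  apply/setP => a; apply/idP/idP.
    move=> h0; have h1 v : v \in t -> a \in common_star (join_points [:: v] G).
      elim: (t) h0 => // u t' IHt; rewrite big_cons inE => /andP [au at'].
      by rewrite inE => /orP [/eqP ->|/(IHt at')].
    have [v vt] : exists v, v \in t.
      by case: (t) t0 => // v t' _; exists v; rewrite mem_head.
    have /common_starP [a0 av] := h1 v vt.
    apply/common_starP; split=> // g /join_pointsP [gG|[u ut gu]].
      by apply: av; apply/join_pointsP; left.
    have /common_starP [_] := h1 u ut; apply; apply/join_pointsP; right.
    by exists u; rewrite ?mem_head.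
  move=> /common_starP [a0 h0].
  elim: (t) {t0 ts} h0 => [|u t' IHt] h0; first by rewrite big_nil inE.
  rewrite big_cons inE; apply/andP; split; last first.
    apply: IHt => g /join_pointsP [gG|[v vt gv]]; apply: h0; apply/join_pointsP.
      by left.
    by right; exists v; rewrite // inE vt orbT.
  apply/common_starP; split=> // g /join_pointsP [gG|[v]].
    by apply: h0; apply/join_pointsP; left.
  rewrite inE => /eqP -> gv; apply: h0; apply/join_pointsP; right.
  by exists u; rewrite // mem_head.
(* The star of one vertex is a cone with that vertex as apex, hence connected in every degree. *)
case: t t0 ts => // v [|v' t] _ ts.
  have vs : v \in s by apply: ts; rewrite mem_head.
  apply: (@cone_conn _ _ v).
  - exact: common_star_closed.
  - exact: set0_common_star.
  - apply/common_starP; split=> // g /join_pointsP [gG|[u]].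
      by move: vs; rewrite memsE => /common_starP [_]; apply.
    rewrite inE => /eqP -> [g' gG ->]; rewrite setUA setUid.
    by move: vs; rewrite memsE => /common_starP [_]; apply.
  - move=> a /common_starP [a0 aG]; apply/common_starP; split.
      by apply/set0Pn; exists v; rewrite setU11.
    move=> g /join_pointsP [gG|[u]].
      rewrite -setUA (setUC a) setUA setUC; apply: aG; apply/join_pointsP; right.
      by exists v; rewrite ?mem_head //; exists g.
    rewrite inE => /eqP -> [g' gG ->]; rewrite setUACA setUid setUCA.
    apply: aG; apply/join_pointsP; right.
    by exists v; rewrite ?mem_head //; exists g'.
rewrite /=; set k := size t.
have [hk|hk] := leqP h.+3 k.+2.
  by move: hk; rewrite -subn_eq0 => /eqP ->; apply: conn0.
apply: IH => //.
- by move: hk hn; lia.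
- exact: join_points_down_closed.
- exact: jX.
(* The join with [k + 2] points has at most [(k + 3) * #|G|] members, and [k + 3 <= 3 ^ (k + 1)]
   fits the budget. *)
apply: leq_trans GN.
apply: leq_trans (leq_mul (card_join_points _ _) (leqnn _)) _.
rewrite /= -/k mulnAC mulnC leq_mul2l; apply/orP; right.
have -> : (h.+3 - k.+2).-1 = h - k by lia.
have -> : 3 ^ h.+1 = 3 ^ (h - k) * 3 ^ k.+1 by rewrite -expnD; congr (_ ^ _); lia.
rewrite mulnC leq_mul2l; apply/orP; right.
by elim: k {hk} => // k IHk; rewrite expnS; lia.
Qed.

Lemma conic_conn q : conic (3 ^ q) -> conn X q.+1.
Proof.
move=> cone; have -> : X = common_star [set set0].
  apply/setP => a; apply/idP/common_starP => [aX|[_]].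
    split; first by apply: contraNneq X0 => <-.
    by move=> g /set1P ->; rewrite setU0.
  by move/(_ set0); rewrite setU0; apply; rewrite inE.
apply: common_star_conn cone _ _ _; last by rewrite cards1 mul1n.
- by split=> [|a b /set1P ->]; rewrite !inE // subset0.
- by rewrite setDv sub0set.
Qed.

End Conic.

(** * Geometric realisations *)

From mathcomp Require Import all_classical all_reals all_analysis.

Import Order.TTheory GRing.Theory Num.Theory.
Import numFieldNormedType.Exports.

Local Open Scope classical_set_scope.
Local Open Scope ring_scope.

(** Points are plain coordinate functions, without a topology; a map between them counts as
    continuous when it preserves this condition for every test space [S]. *)
Definition cts_at (R : realType) (S : topologicalType) (s : S) (T : Type)
    (phi : S -> T -> R) :=
  forall a, (fun z => phi z a) @ s --> phi s a.

Section Continuity.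
Variables (R : realType) (S : topologicalType) (s : S).

Lemma cvgr_sum (I : Type) (r : seq I) (P : pred I) (F : I -> S -> R) :
  (forall i, P i -> F i @ s --> F i s) ->
  (fun z => \sum_(i <- r | P i) F i z) @ s --> \sum_(i <- r | P i) F i s.
Proof. by move=> cF; apply: cvg_big => //; exact: add_continuous. Qed.

Lemma cvgr_prod (I : Type) (r : seq I) (P : pred I) (F : I -> S -> R) :
  (forall i, P i -> F i @ s --> F i s) ->
  (fun z => \prod_(i <- r | P i) F i z) @ s --> \prod_(i <- r | P i) F i s.
Proof. by move=> cF; apply: cvg_big => //; exact: mul_continuous. Qed.

Lemma cvgr_max0 (F : S -> R) :
  F @ s --> F s -> (fun z => Num.max 0 (F z)) @ s --> Num.max 0 (F s).
Proof.
by move=> cF; apply: (@continuous_max R S (fun=> 0) F s) => //; exact: cvg_cst.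
Qed.

End Continuity.

Section Realisation.
Variable R : realType.

Definition supp (T : finType) (x : T -> R) : {set T} := [set a | x a != 0]%SET.

Definition geom (T : finType) (Y : {set {set T}}) (x : T -> R) :=
  [/\ forall a, 0 <= x a, \sum_a x a = 1 & supp x \in Y].

Lemma suppP (T : finType) (x : T -> R) a : (a \in supp x) = (x a != 0).
Proof. by rewrite inE. Qed.

(* Positive exactly when [c] is the set of the [#|c|] largest, strictly positive,
   coordinates of [x]: up to normalisation, the barycentric coordinates of [x] in
   the barycentric subdivision. *)
Definition level_weight (T : finType) (x : T -> R) (c : {set T}) : R :=
  \prod_(a in c) Num.max 0 (x a) *
  \prod_(a in c) \prod_(b in (~: c)%SET) Num.max 0 (x a - x b).

Lemma level_weight_ge0 (T : finType) (x : T -> R) (c : {set T}) : 0 <= level_weight x c.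
Proof.
apply: mulr_ge0; first by apply: prodr_ge0 => a _; rewrite le_max lexx.
by apply: prodr_ge0 => a _; apply: prodr_ge0 => b _; rewrite le_max lexx.
Qed.

Lemma level_weight_neq0 (T : finType) (x : T -> R) (c : {set T}) :
  reflect ({in c, forall a, 0 < x a} /\
           forall a b, a \in c -> b \notin c -> x b < x a)
    (level_weight x c != 0).
Proof.
have max0 (r : R) : (Num.max 0 r != 0) = (0 < r).
  by rewrite maxEge; case: ltrgt0P => //; rewrite ?eqxx // => /gt_eqF ->.
rewrite mulf_eq0 negb_or; apply: (iffP andP).
  move=> [/prodf_neq0 h1 /prodf_neq0 h2]; split=> [a ac|a b ac bc].
    by rewrite -max0 h1.
  have /prodf_neq0 := h2 a ac; move/(_ b).
  by rewrite inE bc max0 subr_gt0; apply.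
move=> [h1 h2]; split; apply/prodf_neq0 => a ac; first by rewrite max0 h1.
by apply/prodf_neq0 => b; rewrite inE max0 subr_gt0 => bc; apply: h2.
Qed.

Lemma level_weight_cts (S : topologicalType) (s : S) (T : finType)
    (phi : S -> T -> R) (c : {set T}) :
  cts_at s phi ->
  (fun z => level_weight (phi z) c) @ s --> level_weight (phi s) c.
Proof.
move=> cphi; apply: cvgM.
  by apply: cvgr_prod => a _; apply: cvgr_max0; exact: cphi.
apply: cvgr_prod => a _; apply: cvgr_prod => b _; apply: cvgr_max0.
by apply: cvgB; exact: cphi.
Qed.

Definition total_weight (T : finType) (P : {set {set T}}) (x : T -> R) : R :=
  \sum_(c in P) level_weight x c.

Lemma total_weight_ge0 (T : finType) (P : {set {set T}}) x : 0 <= total_weight P x.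
Proof. by apply: sumr_ge0 => c _; exact: level_weight_ge0. Qed.

Lemma total_weight_gt0 (T : finType) (P : {set {set T}}) x (c : {set T}) :
  c \in P -> level_weight x c != 0 -> 0 < total_weight P x.
Proof.
move=> cP c0; rewrite /total_weight (bigD1 c) //=; apply: ltr_pwDl.
  by rewrite lt_neqAle eq_sym c0 level_weight_ge0.
by apply: sumr_ge0 => d _; exact: level_weight_ge0.
Qed.

Lemma total_weight_cts (S : topologicalType) (s : S) (T : finType)
    (P : {set {set T}}) (phi : S -> T -> R) :
  cts_at s phi ->
  (fun z => total_weight P (phi z)) @ s --> total_weight P (phi s).
Proof.
by move=> cphi; apply: cvgr_sum => c _; exact: level_weight_cts.
Qed.

(** Where the total weight is positive, this lands in the order complex of [P]; elsewhere all values
    are 0. *)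
Definition sdmap (T : finType) (P : {set {set T}}) (x : T -> R) (c : {set T}) : R :=
  if c \in P then level_weight x c / total_weight P x else 0.

Lemma sdmap_neq0 (T : finType) (P : {set {set T}}) (x : T -> R) (c : {set T}) :
  sdmap P x c != 0 -> c \in P /\ level_weight x c != 0.
Proof.
rewrite /sdmap; case: ifP => [cP|]; last by rewrite eqxx.
by rewrite mulf_eq0 negb_or => /andP [].
Qed.

Lemma level_weight_sub_supp (T : finType) (x : T -> R) (c : {set T}) :
  level_weight x c != 0 -> (c \subset supp x)%SET.
Proof.
move=> /level_weight_neq0 [h _]; apply/fintype.subsetP => a /h.
by rewrite suppP lt0r => /andP [].
Qed.

Lemma sum1_supp0 (T : finType) (x : T -> R) : \sum_a x a = 1 -> supp x != finset.set0.
Proof.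
move=> x1; apply: contra_eq_neq x1 => s0; rewrite big1 1?eq_sym ?oner_eq0 //.
move=> a _; apply/eqP; have : a \notin supp x by rewrite s0 inE.
by rewrite suppP negbK.
Qed.

(** Two level sets of the same function are always nested. *)
Lemma sdmap_geom (T : finType) (P : {set {set T}}) (x : T -> R) :
  0 < total_weight P x -> geom (sd P) (sdmap P x).
Proof.
move=> w0; have s1 : \sum_c sdmap P x c = 1.
  by rewrite -big_mkcond /= -mulr_suml divff // gt_eqF.
split=> // [c|].
  by rewrite /sdmap; case: ifP => // _; rewrite divr_ge0 ?level_weight_ge0 // ltW.
apply/sdP; split.
- by apply/fintype.subsetP => c; rewrite suppP => /sdmap_neq0 [].
- exact: sum1_supp0.
apply/chainP => c d; rewrite !suppP => /sdmap_neq0 [_ /level_weight_neq0 [_ hc]].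
move=> /sdmap_neq0 [_ /level_weight_neq0 [_ hd]].
apply/orP; have [cd|/subsetPn [a ac ad]] := boolP (c \subset d)%SET; first by left.
right; apply/fintype.subsetP => b bd; apply: contraT => bc.
by have := lt_trans (hc a b ac bc) (hd b a bd ad); rewrite ltxx.
Qed.

Lemma sdmap_cts (S : topologicalType) (s : S) (T : finType) (P : {set {set T}})
    (phi : S -> T -> R) :
  cts_at s phi -> 0 < total_weight P (phi s) ->
  cts_at s (fun z => sdmap P (phi z)).
Proof.
move=> cphi w0 c; rewrite /sdmap; case: ifP => _; last exact: cvg_cst.
apply: cvgM; first exact: level_weight_cts.
by apply: cvgV; [rewrite gt_eqF | exact: total_weight_cts].
Qed.

Lemma supp_weight (T : finType) (Y : {set {set T}}) x :
  geom Y x -> level_weight x (supp x) != 0.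
Proof.
move=> [x0 _ _]; apply/level_weight_neq0; split=> [a|a b].
  by rewrite suppP lt0r x0 andbT.
by rewrite !suppP negbK => a0 /eqP ->; rewrite lt0r a0 x0.
Qed.

Definition bary (T : finType) (g : {set T}) (w : T) : R := (w \in g)%:R / #|g|%:R.

Lemma bary_sum (T : finType) (g : {set T}) : g != finset.set0 -> \sum_w bary g w = 1.
Proof.
move=> g0; rewrite -mulr_suml -natr_sum; have -> : (\sum_i (i \in g) = #|g|)%N.
  by rewrite -sum1_card [RHS]big_mkcond /=; apply: eq_bigr => i _; case: (_ \in _).
by rewrite divff // pnatr_eq0 -lt0n card_gt0.
Qed.

(** Vertices go to barycentres, and each subdivision is absorbed by passing to subdivided
    coordinates. On [L] only the carrier is recorded, which suffices for straight-line
    homotopies. *)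
Lemma ext_realise (W : finType) (Y : {set {set W}}) :
  face_closed Y -> finset.set0 \notin Y ->
  forall m (V : finType) (K L : {set {set V}}) (f : {set V} -> {set W}),
  (L \subset K)%SET -> ext Y m K L f ->
  exists Phi : ({set V} -> R) -> (W -> R),
    [/\ forall x, geom (sd K) x -> geom Y (Phi x),
        forall (S : topologicalType) (s : S) (phi : S -> {set V} -> R),
          cts_at s phi -> geom (sd K) (phi s) -> cts_at s (fun z => Phi (phi z))
      & forall x, geom (sd L) x -> forall w, Phi x w != 0 ->
          exists2 a, a \in supp x & w \in f a].
Proof.
move=> cY Y0; elim=> [|m IH] V K L f LK.
  move=> [g [gY ga] gf]; exists (fun x w => \sum_a x a * bary (g a) w).
  have supp_in x w : \sum_a x a * bary (g a) w != 0 ->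
      exists2 a, a \in supp x & w \in g a.
    move=> h; apply/exists_inP; apply: contraNT h.
    rewrite negb_exists_in => /forall_inP h; rewrite big1 // => a _.
    have [->|xa] := eqVneq (x a) 0; first by rewrite mul0r.
    by rewrite /bary (negPf (h a _)) ?suppP // !mul0r mulr0.
  split=> [x [x0 x1 /sdP [/fintype.subsetP xK xn0 ch]]|S s phi cphi _ w|x].
  - have sum1 : \sum_w \sum_a x a * bary (g a) w = 1.
      rewrite exchange_big /= -[RHS]x1; apply: eq_bigr => a _.
      have [->|xa] := eqVneq (x a) 0; first by rewrite big1 // => w _; rewrite mul0r.
      rewrite -mulr_sumr bary_sum ?mulr1 //.
      have /gY : a \in K by apply: xK; rewrite suppP.
      by apply: contraTneq => ->.
    split=> // [w|].
      by apply: sumr_ge0 => a _; rewrite mulr_ge0 // divr_ge0.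
    (* As [g] reverses inclusion, its value at the smallest member contains all the others and
       carries the image. *)
    have [a aC bot] := chain_bottom ch xn0.
    apply: cY (gY a (xK a aC)) _ (sum1_supp0 sum1).
    apply/fintype.subsetP => w; rewrite suppP => /supp_in [b bC wb].
    by apply: fintype.subsetP wb; apply: ga; rewrite ?xK ?bot.
  - apply: cvgr_sum => a _; apply: cvgM; first exact: cphi.
    exact: cvg_cst.
  - move=> [_ _ /sdP [/fintype.subsetP xL _ _]] w /supp_in [a ax wa].
    by exists a => //; rewrite -gf ?xL.
move=> /= /(IH _ _ _ _ (sdS LK)) [Phi [hY hc hL]].
have w0 x : geom (sd K) x -> 0 < total_weight (sd K) x.
  by move=> xK; case: (xK) => _ _; move/total_weight_gt0; apply; exact: supp_weight xK.
exists (fun x => Phi (sdmap (sd K) x)); split=> [x xK|S s phi cphi phiK|x xL w].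
- by apply: hY; apply: sdmap_geom; exact: w0.
- by apply: hc; [apply: sdmap_cts; rewrite ?w0 | apply: sdmap_geom; rewrite w0].
have sLK : (sd L \subset sd K)%SET by exact: sdS.
have xK : geom (sd K) x.
  by case: xL => ? ? ?; split=> //; exact: (fintype.subsetP sLK).
have [] : geom (sd (sd K)) (sdmap (sd K) x) by apply: sdmap_geom; exact: w0.
move=> y0 y1 yK.
have yL : geom (sd (sd L)) (sdmap (sd K) x).
  split=> //; move: yK => /sdP [yK yn0 ch]; apply/sdP; split=> //.
  apply/fintype.subsetP => c; rewrite suppP => /sdmap_neq0 [cK /level_weight_sub_supp cx].
  case: xL => _ _ xL; apply: sd_closed xL cx _.
  by apply: contraTneq cK => ->; exact: set0_sd.
move=> /(hL _ yL) [c]; rewrite suppP => /sdmap_neq0 [cK /level_weight_sub_supp cx] wc.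
have /sdP [_ /set0Pn [a ac] _] := cK.
exists a; first exact: (fintype.subsetP cx).
by move/finset.bigcapP: wc; apply.
Qed.

End Realisation.

(** * Homotopies between maps into a realisation *)

Section Homotopies.
Variable R : realType.

Definition clamp (t : R) : R := Num.max 0 (Num.min 1 t).

Lemma clamp_ge0 t : 0 <= clamp t. Proof. by rewrite le_max lexx. Qed.

Lemma clamp_le1 t : clamp t <= 1.
Proof. by rewrite ge_max ler01 ge_min lexx. Qed.

Lemma clamp_le0 t : t <= 0 -> clamp t = 0.
Proof.
move=> t0; rewrite /clamp min_r; last by apply: le_trans t0 _.
by rewrite max_l.
Qed.

Lemma clamp_ge1 t : 1 <= t -> clamp t = 1.
Proof. by move=> t1; rewrite /clamp min_l // max_r. Qed.

Lemma clamp_cts (S : topologicalType) (s : S) (tau : S -> R) :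
  tau @ s --> tau s -> (fun z => clamp (tau z)) @ s --> clamp (tau s).
Proof.
move=> ctau; apply: cvgr_max0.
by apply: (@continuous_min R S (fun=> 1) tau s) => //; exact: cvg_cst.
Qed.

Definition const (T W : Type) (p : W -> R) : (T -> R) -> W -> R := fun=> p.

(* A homotopy is extended to all times by being constant before 0 and after 1. *)
Definition hty (T W : finType) (Y : {set {set W}}) (D : (T -> R) -> Prop)
    (F G : (T -> R) -> W -> R) :=
  exists H : (T -> R) -> R -> W -> R,
    [/\ forall x t, D x -> geom Y (H x t),
        forall x (t : R), D x -> t <= 0 -> H x t = F x,
        forall x (t : R), D x -> 1 <= t -> H x t = G x
      & forall (S : topologicalType) (s : S) (phi : S -> T -> R) (tau : S -> R),
          cts_at s phi -> tau @ s --> tau s -> D (phi s) ->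
          cts_at s (fun z => H (phi z) (tau z))].

Section Basics.
Variables (T W : finType) (Y : {set {set W}}).
Implicit Types (D : (T -> R) -> Prop) (F G E : (T -> R) -> W -> R).

Lemma hty_sym D F G : hty Y D F G -> hty Y D G F.
Proof.
move=> [H [HY H0 H1 Hc]]; exists (fun x t => H x (1 - t)); split=> [x t|x t Dx t0|x t Dx t1|].
- exact: HY.
- by rewrite H1 // lerBrDr gerDl.
- by rewrite H0 // subr_le0.
- move=> S s phi tau cphi ctau Ds; apply: Hc => //.
  by apply: cvgB => //; exact: cvg_cst.
Qed.

Lemma hty_trans D F G E : hty Y D F G -> hty Y D G E -> hty Y D F E.
Proof.
move=> [H [HY H0 H1 Hc]] [H' [HY' H0' H1' Hc']].
(* On each half one of the terms cancels, so that no case analysis on [t] is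
   needed for continuity. *)
pose K x t w := H x (2 * t) w + H' x (2 * t - 1) w - H x 1 w.
have Kl x t : D x -> t <= 1 / 2 -> K x t = H x (2 * t).
  move=> Dx t2; apply/funext => w; rewrite /K H0' // ?(H1 x 1) ?addrK //.
  by rewrite subr_le0 mulrC -ler_pdivlMr.
have Kr x t : D x -> 1 / 2 <= t -> K x t = H' x (2 * t - 1).
  move=> Dx t2; apply/funext => w; rewrite /K !H1 //; first by rewrite addrAC subrr add0r.
  by rewrite mulrC -ler_pdivrMr.
exists K; split=> [x t Dx|x t Dx t0|x t Dx t1|S s phi tau cphi ctau Ds w].
- by have [/(Kl _ _ Dx) ->|/ltW /(Kr _ _ Dx) ->] := lerP t (1 / 2); [apply: HY|apply: HY'].
- rewrite Kl //; last by apply: le_trans t0 _; rewrite divr_ge0.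
  by rewrite H0 // mulr_ge0_le0.
- rewrite Kr //; last by apply: le_trans t1; rewrite ler_pdivrMr // mul1r ler1n.
  by rewrite H1' // lerBrDr -[1 + 1]mulr1 ler_pM2l.
have c2 : (fun z => 2 * tau z) @ s --> 2 * tau s.
  by apply: cvgM => //; exact: cvg_cst.
apply: cvgB; last by apply: (Hc _ _ _ (fun=> 1)) => //; exact: cvg_cst.
apply: cvgD; first by apply: (Hc _ _ _ (fun z => 2 * tau z)).
by apply: (Hc' _ _ _ (fun z => 2 * tau z - 1)) => //; apply: cvgB => //; exact: cvg_cst.
Qed.

Lemma hty_sub D D' F G : (forall x, D x -> D' x) -> hty Y D' F G -> hty Y D F G.
Proof.
move=> DD [H [HY H0 H1 Hc]].
exists H; split=> [x t /DD|x t /DD|x t /DD|S s phi tau cphi ctau /DD]; by auto.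
Qed.

(** The test [b] is locally constant at the points of both pieces, so choosing the homotopy by [b]
    is continuous. *)
Lemma hty_or D D' F G (b : (T -> R) -> bool) :
  (forall (S : topologicalType) (s : S) (phi : S -> T -> R), cts_at s phi ->
     D (phi s) -> \forall z \near s, b (phi z)) ->
  (forall (S : topologicalType) (s : S) (phi : S -> T -> R), cts_at s phi ->
     D' (phi s) -> \forall z \near s, ~~ b (phi z)) ->
  hty Y D F G -> hty Y D' F G -> hty Y (fun x => D x \/ D' x) F G.
Proof.
move=> bD bD' [H [HY H0 H1 Hc]] [H' [HY' H0' H1' Hc']].
have ccst x : cts_at (0 : R) (fun=> x : T -> R) by move=> a; exact: cvg_cst.
have bt x : D x -> b x.
  by move=> Dx; have := bD _ _ _ (ccst x) Dx; exact: nbhs_singleton.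
have bf x : D' x -> b x = false.
  by move=> Dx; have := bD' _ _ _ (ccst x) Dx; move/nbhs_singleton/negPf.
exists (fun x t => if b x then H x t else H' x t).
split=> [x t []|x t []|x t []|S s phi tau cphi ctau Ds w].
- by move=> Dx; rewrite bt //; apply: HY.
- by move=> Dx; rewrite bf //; apply: HY'.
- by move=> Dx; rewrite bt //; apply: H0.
- by move=> Dx; rewrite bf //; apply: H0'.
- by move=> Dx; rewrite bt //; apply: H1.
- by move=> Dx; rewrite bf //; apply: H1'.
case: Ds => Ds.
  rewrite bt //; apply: cvg_trans (Hc _ _ _ _ cphi ctau Ds w).
  apply: near_eq_cvg; have := bD _ _ _ cphi Ds.
  by apply: filterS => z ->.
rewrite bf //; apply: cvg_trans (Hc' _ _ _ _ cphi ctau Ds w).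
apply: near_eq_cvg; have := bD' _ _ _ cphi Ds.
by apply: filterS => z /negPf ->.
Qed.

Definition cts_on D F := forall (S : topologicalType) (s : S) (phi : S -> T -> R),
  cts_at s phi -> D (phi s) -> cts_at s (fun z => F (phi z)).

Lemma hty_line D F G :
  face_closed Y -> cts_on D F -> cts_on D G ->
  (forall x, D x -> geom Y (F x)) -> (forall x, D x -> geom Y (G x)) ->
  (forall x, D x -> exists2 e, e \in Y &
     (supp (F x) \subset e)%SET /\ (supp (G x) \subset e)%SET) ->
  hty Y D F G.
Proof.
move=> cY cF cG FY GY sup.
exists (fun x t w => (1 - clamp t) * F x w + clamp t * G x w).
have c0 t : 0 <= 1 - clamp t by rewrite subr_ge0 clamp_le1.
split=> [x t Dx|x t Dx t0|x t Dx t1|S s phi tau cphi ctau Ds w].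
- have [F0 F1 _] := FY x Dx; have [G0 G1 _] := GY x Dx.
  have [e eY [/fintype.subsetP Fe /fintype.subsetP Ge]] := sup x Dx.
  have s1 : \sum_w ((1 - clamp t) * F x w + clamp t * G x w) = 1.
    by rewrite big_split /= -!mulr_sumr F1 G1 !mulr1 subrK.
  split=> // [w|]; first by rewrite addr_ge0 // mulr_ge0 ?clamp_ge0.
  apply: cY eY _ (sum1_supp0 s1); apply/fintype.subsetP => w; rewrite suppP.
  have [/Fe //|Fw] := boolP (w \in supp (F x)).
  have [/Ge //|Gw] := boolP (w \in supp (G x)).
  by move: Fw Gw; rewrite !suppP !negbK => /eqP -> /eqP ->; rewrite !mulr0 addr0 eqxx.
- by apply/funext => w; rewrite clamp_le0 // subr0 mul1r mul0r addr0.
- by apply/funext => w; rewrite clamp_ge1 // subrr mul0r mul1r add0r.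
apply: cvgD; apply: cvgM; try exact: cF; try exact: cG; last exact: clamp_cts.
by apply: cvgB; [exact: cvg_cst|exact: clamp_cts].
Qed.

End Basics.

Lemma hty_pre (T T' W : finType) (Y : {set {set W}}) (D : (T -> R) -> Prop)
    (D' : (T' -> R) -> Prop) F G (E : (T' -> R) -> T -> R) :
  cts_on D' E -> (forall x, D' x -> D (E x)) -> hty Y D F G ->
  hty Y D' (fun x => F (E x)) (fun x => G (E x)).
Proof.
move=> cE DD [H [HY H0 H1 Hc]]; exists (fun x t => H (E x) t).
split=> [x t /DD|x t /DD|x t /DD|S s phi tau cphi ctau Ds]; auto.
Qed.

Lemma hty_post (T V W : finType) (K : {set {set V}}) (Y : {set {set W}})
    (D : (T -> R) -> Prop) F G (Phi : (V -> R) -> W -> R) :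
  (forall x, geom K x -> geom Y (Phi x)) -> cts_on (geom K) Phi ->
  hty K D F G -> hty Y D (fun x => Phi (F x)) (fun x => Phi (G x)).
Proof.
move=> PhiY cPhi [H [HY H0 H1 Hc]]; exists (fun x t => Phi (H x t)).
split=> [x t Dx|x t Dx t0|x t Dx t1|S s phi tau cphi ctau Ds].
- by auto.
- by rewrite H0.
- by rewrite H1.
- by apply: cPhi; auto.
Qed.

(** * Contracting a neighbourhood of an order complex *)

Section Contraction.
Variables (W : finType) (X P : {set {set W}}) (q : nat).
Hypotheses (cX : face_closed X) (X0 : finset.set0 \notin X).

Definition near_part (Q : {set {set W}}) (x : W -> R) := geom X x /\ 0 < total_weight Q x.

(* The part of [X] near the simplexes of [P] retracts to the order complex of
   [P], over which the extension property provides a cone. *)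
Lemma contractible_part :
  (P \subset X)%SET -> height P q -> conn X q.+1 ->
  exists2 p : W -> R, geom X p & hty X (near_part P) id (const p).
Proof.
move=> PX hP cnX.
have P0 : finset.set0 \notin P by apply: contra X0; exact: fintype.subsetP.
(* The empty chain lies below all others and serves as cone point; adding it raises the height from
   [q] to at most [q + 1], whence the index of [conn]. *)
pose L : {set {set {set W}}} := sd P; pose K := (finset.set0 |: L)%SET.
have [m em] : exists m, ext X m K L (pull id).
  apply: cnX; first exact: finset.subsetUr.
    move=> C CK ch; rewrite (cardsD1 finset.set0) -add1n; apply: leq_add.
      by case: (_ \in _).
    apply: (@sd_height _ P) => //; last by apply: chainS ch; exact: subD1set.
    apply/fintype.subsetP => c /setD1P [c0 /(fintype.subsetP CK)].
    by rewrite inE finset.in_set1 (negPf c0).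
  split=> [C /sdP [/fintype.subsetP CP C0 ch]|C D _ _]; last exact: pull_anti.
  have [a aC bot] := chain_bottom ch C0.
  apply: (fintype.subsetP PX); suff -> : pull id C = a by exact: CP.
  apply/eqP; rewrite finset.eqEsubset pull_sub //=.
  by apply/finset.bigcapsP => b; exact: bot.
have LK : (L \subset K)%SET by exact: finset.subsetUr.
have [Phi [hY hc hL]] := ext_realise R cX X0 LK em.
(* The vertices of [sd K] are already chains, so level sets are taken twice: first to reach [sd P],
   then [sd (sd P)]. *)
pose la (x : W -> R) := sdmap L (sdmap P x).
pose apex (c : {set {set W}}) : R := (c == finset.set0)%:R.
have cchain : chain [set finset.set0 : {set {set W}}]%SET.
  by apply/chainP => a b /finset.set1P -> /finset.set1P ->; rewrite fintype.subxx.
have sapex : supp apex = [set finset.set0]%SET :> {set {set {set W}}}.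
  by apply/finset.setP => c; rewrite suppP finset.in_set1 pnatr_eq0 eqb0 negbK.
have gapex : geom (sd K) apex.
  split=> [c|| ]; first by rewrite ler0n.
    rewrite (bigD1 finset.set0) //= /apex eqxx big1 ?addr0 // => c /negPf ->.
    by [].
  rewrite sapex; apply/sdP; split=> //; first by rewrite finset.sub1set finset.setU11.
  by apply/set0Pn; exists finset.set0; rewrite finset.set11.
have w1 x : near_part P x -> geom (sd P) (sdmap P x).
  by move=> [_ w0]; exact: sdmap_geom.
have w2 x : near_part P x -> 0 < total_weight L (sdmap P x).
  move=> /w1 g; apply: total_weight_gt0 (supp_weight g).
  by case: g.
have gla x : near_part P x -> geom (sd L) (la x).
  by move=> /w2; exact: sdmap_geom.
have glaK x : near_part P x -> geom (sd K) (la x).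
  by move=> /gla [? ? h]; split=> //; exact: fintype.subsetP (sdS LK) _ h.
have cla : cts_on (near_part P) la.
  move=> S s phi cphi Ps; apply: sdmap_cts; last exact: w2.
  by apply: sdmap_cts => //; case: Ps.
exists (Phi apex); first exact: hY.
(* The carrier condition keeps [Phi (la x)] in the simplex [supp x], where a segment joins it to
   [x]. *)
apply: (hty_trans (G := fun x => Phi (la x))).
  apply: hty_line => //.
  - by move=> S s phi cphi Ps; apply: (hc _ _ (fun z => la (phi z))); [exact: cla|exact: glaK].
  - by move=> x [].
  - by move=> x Px; apply: hY; exact: glaK.
  move=> x Px; exists (supp x); first by case: Px => -[].
  split=> //; apply/fintype.subsetP => w; rewrite suppP.
  move=> /(hL _ (gla x Px)) [C]; rewrite suppP => /sdmap_neq0 [CL].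
  move=> /level_weight_sub_supp /fintype.subsetP Cs wC.
  have /sdP [_ /set0Pn [c cC] _] := CL.
  have := Cs c cC; rewrite suppP => /sdmap_neq0 [_ /level_weight_sub_supp /fintype.subsetP].
  by apply; move/finset.bigcapP: wC; apply.
(* [Phi] carries the contraction of the cone to its apex into [X]. *)
have := @hty_post W {set {set W}} W (sd K) X (near_part P) la (const apex) Phi hY.
apply.
  by move=> S s phi cphi Ps; exact: hc.
apply: hty_line => //.
- exact: sd_closed.
- by move=> S s phi cphi Ps a; exact: cvg_cst.
move=> x Px; exists (finset.set0 |: supp (la x))%SET; last first.
  by rewrite sapex finset.subsetUr finset.subsetUl.
have [_ _ /sdP [sL s0 /chainP ch]] := gla x Px.
apply/sdP; split.
- by apply: finset.setUS.
- by apply/set0Pn; exists finset.set0; rewrite finset.setU11.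
apply/chainP => a b /setU1P [->|aL] /setU1P [->|bL]; rewrite ?finset.sub0set ?orbT //.
exact: ch.
Qed.

End Contraction.
End Homotopies.

(** * The bound on TC *)

Section SmallComplexes.
Variables (R : realType) (n : nat) (X : subcomplex n).

Lemma subcomplex_closed : face_closed X.
Proof.
move=> a b bX ab a0; have /forall_inP/(_ b bX)/andP [_ /forallP/(_ a)] := subcomplexP X.
by rewrite a0 ab.
Qed.

Lemma set0_subcomplex : finset.set0 \notin (X : {set {set 'I_n}}).
Proof.
by apply/negP => h; have /forall_inP/(_ _ h) := subcomplexP X; rewrite eqxx.
Qed.

Let T : Type := realisation R X.

Definition coord (x : T) (i : 'I_n) : R := (set_val x : 'rV[R]_n) ord0 i.

Definition coords (z : T * T) (i : 'I_n + 'I_n) : R :=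
  match i with inl j => coord z.1 j | inr j => coord z.2 j end.

Lemma geom_coord (x : T) : geom X (coord x).
Proof. by case: x => x /= h; have := set_mem h; case. Qed.

Lemma coord_cts (x : T) : cts_at x coord.
Proof.
move=> i.
apply: (@cvg_comp _ _ _ (set_val : T -> 'rV[R]_n) (fun M : 'rV[R]_n => M ord0 i) _
  (nbhs (set_val x))); last exact: coord_continuous.
exact: initial_continuous.
Qed.

Lemma coords_cts (z : T * T) : cts_at z coords.
Proof.
case=> i /=.
  apply: (@cvg_comp _ _ _ (@fst T T) (fun y => coord y i) _ (nbhs z.1)).
    exact: cvg_fst.
  exact: coord_cts.
apply: (@cvg_comp _ _ _ (@snd T T) (fun y => coord y i) _ (nbhs z.2)).
  exact: cvg_snd.
exact: coord_cts.
Qed.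

Lemma cvg_realisation (S : topologicalType) (f : S -> T) :
  (forall s : S, cts_at s (fun y : S => coord (f y))) -> continuous f.
Proof.
move=> cf; apply: (@continuous_comp_initial _ _ _ set_val) => s A [P hP sPA].
have : \forall y \near s, forall i j, P i j (set_val (f y) i j).
  apply: filter_forall => i; apply: filter_forall => j.
  by rewrite (ord1 i); apply: (cf s j (P ord0 j)); exact: hP.
by apply: filterS => z Pz; apply: sPA.
Qed.

Lemma hty_homotopic (U : set (T * T)) (D : ('I_n + 'I_n -> R) -> Prop) :
  (forall z, U z -> D (coords z)) ->
  hty X D (fun x => x \o inl) (fun x => x \o inr) ->
  homotopic R (fun z : U => (set_val z).1) (fun z : U => (set_val z).2).
Proof.
move=> UD [H [HY H0 H1 Hc]].
have DU (z : U) : D (coords (set_val z)).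
  by apply: UD; exact: set_valP.
have mem (a : U * R) :
    \row_j H (coords (set_val a.1)) a.2 j \in (realisation R X : set 'rV[R]_n).
  apply/mem_set; have [h0 h1 h2] := HY _ a.2 (DU a.1).
  split=> [i||]; rewrite ?mxE //.
    by rewrite -[RHS]h1; apply: eq_bigr => i _; rewrite mxE.
  suff -> : [set i | (\row_j H (coords (set_val a.1)) a.2 j) ord0 i != 0]%SET =
            supp (H (coords (set_val a.1)) a.2) by [].
  by apply/finset.setP => i; rewrite !inE mxE.
have coordE (x y : T) : coord x =1 coord y -> x = y.
  by move=> xy; apply: val_inj; apply/rowP => i; exact: xy.
pose J (a : U * R) : T := exist (fun v => v \in (realisation R X : set 'rV[R]_n)) _ (mem a).
have JE a j : coord (J a) j = H (coords (set_val a.1)) a.2 j.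
  by rewrite /coord set_valE /= mxE.
exists J; split=> [|a|a].
- apply: continuous_subspaceT; apply: cvg_realisation => a j.
  rewrite JE; under eq_cvg do rewrite JE.
  have cphi : cts_at a (fun z : U * R => coords (set_val z.1)).
    move=> i; apply: (@cvg_comp _ _ _ (fun z : U * R => set_val z.1)
      (fun y => coords y i) _ (nbhs (set_val a.1))); last exact: coords_cts.
    apply: (@cvg_comp _ _ _ (@fst U R) set_val _ (nbhs a.1)); first exact: cvg_fst.
    exact: initial_continuous.
  have ctau : (fun z : U * R => z.2) @ a --> a.2 by exact: cvg_snd.
  exact: (Hc _ a _ _ cphi ctau (DU a.1) j).
- apply: coordE => j; rewrite JE H0 //; exact: DU.
- apply: coordE => j; rewrite JE H1 //; exact: DU.
Qed.

Lemma open_weight (f g : ('I_n + 'I_n -> R) -> R) :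
  (forall (S : topologicalType) (s : S) (phi : S -> 'I_n + 'I_n -> R),
     cts_at s phi -> (fun z => f (phi z)) @ s --> f (phi s)) ->
  (forall (S : topologicalType) (s : S) (phi : S -> 'I_n + 'I_n -> R),
     cts_at s phi -> (fun z => g (phi z)) @ s --> g (phi s)) ->
  open [set z : T * T | f (coords z) < g (coords z)].
Proof.
move=> cf cg; have -> : [set z : T * T | f (coords z) < g (coords z)] =
    (fun z => g (coords z) - f (coords z)) @^-1` [set r | 0 < r].
  by apply/seteqP; split=> z /=; rewrite subr_gt0.
apply: open_comp; last exact: open_gt.
move=> z _; apply: cvgB; first by apply: cg; exact: coords_cts.
by apply: cf; exact: coords_cts.
Qed.

Theorem conic_TC_cover q :
  (0 < q)%N -> conic X (3 ^ q) ->
  (forall s : {set 'I_n}, s \in (X : {set {set 'I_n}}) -> (#|s| <= q.*2)%N) ->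
  TC_cover R (realisation R X) 2.
Proof.
move=> q0 coneX sizeX.
have cX := subcomplex_closed; have X0 := set0_subcomplex.
have connX : conn X q.+1 by exact: conic_conn.
have card0 (s : {set 'I_n}) : s \in (X : {set {set 'I_n}}) -> (0 < #|s|)%N.
  by move=> sX; rewrite card_gt0; apply: contraNneq X0 => <-.
(* Faces with 1 to [q] vertices, and faces with [q + 1] to [2 q]: each class allows [q] cardinals,
   hence height [q]. *)
pose P (b : bool) := [set s in (X : {set {set 'I_n}}) | (#|s| <= q)%N == b]%SET.
have PX b : (P b \subset X)%SET.
  by apply/fintype.subsetP => s; rewrite inE => /andP [].
have hP b : height (P b) q.
  move=> C /fintype.subsetP CP ch; case: b CP => CP.
    apply: (@card_chain _ _ 0) => // s /CP; rewrite inE => /andP [sX /eqP ->].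
    by rewrite card0.
  apply: (@card_chain _ _ q) => // s /CP; rewrite inE addnn => /andP [sX].
  by rewrite eqbF_neg -ltnNge => ->; rewrite sizeX.
have [p' p'X np'] : exists2 p' : bool -> 'I_n -> R, forall b, geom X (p' b) &
    forall b, hty X (near_part X (P b)) id (const (p' b)).
  have [p1 ? ?] := contractible_part R cX X0 (PX true) (hP true) connX.
  have [p2 ? ?] := contractible_part R cX X0 (PX false) (hP false) connX.
  by exists (fun b => if b then p1 else p2); case.
(* Both contractions must end at one point. Each [p' b] slides to a vertex [w] of its support, and
   [w], in [P true] because [0 < q], is moved to [p' true] by the contraction of that part. *)
pose p := p' true.
have np b : hty X (near_part X (P b)) id (const p).
  apply: hty_trans (np' b) _.
  have [_ s1 sX] := p'X b; have /set0Pn [w ws] := sum1_supp0 s1.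
  have wX : [set w]%SET \in (X : {set {set 'I_n}}).
    apply: cX sX _ _; first by rewrite finset.sub1set.
    by rewrite -card_gt0 cards1.
  have sw : supp (bary R [set w]%SET) = [set w]%SET.
    apply/finset.setP => v; rewrite suppP /bary cards1 divr1 pnatr_eq0 eqb0 negbK.
    by [].
  have gw : geom X (bary R [set w]%SET).
    split; last by rewrite sw.
      by move=> v; rewrite divr_ge0.
    by rewrite bary_sum // -card_gt0 cards1.
  have ccst (x : 'I_n -> R) : cts_on (near_part X (P b)) (const x).
    by move=> S s phi _ _ a; exact: cvg_cst.
  apply: (hty_trans (G := const (bary R [set w]%SET))).
    apply: hty_line; [by []|exact: ccst|exact: ccst|by move=> x _; exact: p'X|by move=> x _; exact: gw|].
    move=> x _; exists (supp (p' b)) => //.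
    by rewrite sw finset.sub1set ws.
  apply: (hty_pre (E := const (bary R [set w]%SET)) _ _ (np' true)) => //.
  move=> x _; split=> //; apply: (@total_weight_gt0 _ _ _ _ [set w]%SET).
    by rewrite inE wX cards1 q0.
  by have := supp_weight gw; rewrite sw.
pose tw b (x : 'I_n -> R) := total_weight (P b) x.
have tw_ge0 b x : 0 <= tw b x by exact: total_weight_ge0.
pose D b1 b2 (x : 'I_n + 'I_n -> R) :=
  near_part X (P b1) (x \o inl) /\ near_part X (P b2) (x \o inr).
(* Contract the first coordinate to [p], then run the contraction of the second backwards. *)
have hD b1 b2 : hty X (D b1 b2) (fun x => x \o inl) (fun x => x \o inr).
  apply: (hty_trans (G := const p)).
    apply: (hty_pre (E := fun x => x \o inl) _ _ (np b1)) => [S s phi cphi _ a|x []//].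
    exact: cphi.
  apply: hty_sym.
  apply: (hty_pre (E := fun x => x \o inr) _ _ (np b2)) => [S s phi cphi _ a|x []//].
  exact: cphi.
have cl b (S : topologicalType) (s : S) (phi : S -> 'I_n + 'I_n -> R) : cts_at s phi ->
    (fun z => tw b (phi z \o inl)) @ s --> tw b (phi s \o inl).
  by move=> cphi; apply: (total_weight_cts (phi := fun z => phi z \o inl)) => a; exact: cphi.
have cr b (S : topologicalType) (s : S) (phi : S -> 'I_n + 'I_n -> R) : cts_at s phi ->
    (fun z => tw b (phi z \o inr)) @ s --> tw b (phi s \o inr).
  by move=> cphi; apply: (total_weight_cts (phi := fun z => phi z \o inr)) => a; exact: cphi.
have c0 (S : topologicalType) (s : S) (phi : S -> 'I_n + 'I_n -> R) : cts_at s phi ->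
    (fun z => 0 : R) @ s --> (0 : R) by move=> _; exact: cvg_cst.
(* On the middle open set the two coordinates are contracted along different
   parts; comparing [tw true] splits it into two disjoint open sets. *)
pose b1 (x : 'I_n + 'I_n -> R) := tw true (x \o inr) < tw true (x \o inl).
pose b2 (x : 'I_n + 'I_n -> R) := tw true (x \o inl) < tw true (x \o inr).
have hM : hty X (fun x => (D true false x /\ b1 x) \/ (D false true x /\ b2 x))
    (fun x => x \o inl) (fun x => x \o inr).
  apply: (hty_or (b := b1)).
  - move=> S s phi cphi [_ hs].
    have : 0 < tw true (phi s \o inl) - tw true (phi s \o inr) by rewrite subr_gt0.
    have /cvgr_gt h : (fun z => tw true (phi z \o inl) - tw true (phi z \o inr)) @ s -->
        tw true (phi s \o inl) - tw true (phi s \o inr).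
      by apply: cvgB; [exact: cl|exact: cr].
    by move/h; apply: filterS => z; rewrite subr_gt0.
  - move=> S s phi cphi [_ hs].
    have : 0 < tw true (phi s \o inr) - tw true (phi s \o inl) by rewrite subr_gt0.
    have /cvgr_gt h : (fun z => tw true (phi z \o inr) - tw true (phi z \o inl)) @ s -->
        tw true (phi s \o inr) - tw true (phi s \o inl).
      by apply: cvgB; [exact: cr|exact: cl].
    by move/h; apply: filterS => z; rewrite subr_gt0 /b1 -leNgt => /ltW.
  - by apply: hty_sub (hD true false) => x [].
  - by apply: hty_sub (hD false true) => x [].
pose V b b' : set (T * T) :=
  [set z | 0 < tw b (coords z \o inl)] `&` [set z | 0 < tw b' (coords z \o inr)].
have oV b b' : open (V b b').
  apply: openI.
    exact: (@open_weight (fun=> 0) (fun x => tw b (x \o inl)) c0 (cl b)).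
  exact: (@open_weight (fun=> 0) (fun x => tw b' (x \o inr)) c0 (cr b')).
have DV b b' (z : T * T) : V b b' z -> D b b' (coords z).
  move=> [h1 h2]; split; split=> //; exact: geom_coord.
pose U1 : set (T * T) := (V true false `&` [set z | b1 (coords z)]) `|`
                         (V false true `&` [set z | b2 (coords z)]).
pose U (i : 'I_3) : set (T * T) :=
  match val i with 0%N => V true true | 1%N => U1 | _ => V false false end.
exists U; split=> [i||i].
- rewrite /U; case: (val i) => [|[|_]] //.
  apply: openU; apply: openI => //.
    exact: (@open_weight (fun x => tw true (x \o inr)) (fun x => tw true (x \o inl))
      (cr true) (cl true)).
  exact: (@open_weight (fun x => tw true (x \o inl)) (fun x => tw true (x \o inr))
    (cl true) (cr true)).
- apply/seteqP; split=> // z _.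
  have pos (x : T) : tw true (coord x) = 0 -> 0 < tw false (coord x).
    have gx := geom_coord x; have [_ _ sX] := gx.
    have w := supp_weight gx; case: (boolP (#|supp (coord x)| <= q)%N) => hs.
      move=> h; have : 0 < tw true (coord x).
        by apply: total_weight_gt0 w; rewrite inE sX hs.
      by rewrite h ltxx.
    by move=> _; apply: total_weight_gt0 w; rewrite inE sX (negPf hs).
  have pos' (x : T) : 0 < tw true (coord x) \/ tw true (coord x) = 0.
    have := tw_ge0 true (coord x); rewrite le_eqVlt => /orP [/eqP <-|]; first by right.
    by left.
  (* A coordinate whose [true] weight is zero lies near the large faces; if the other weight is
     positive, the strict comparison in [U1] holds. *)
  case: (pos' z.1) => h1; case: (pos' z.2) => h2.
  + by exists ord0.
  + exists (Ordinal (isT : (1 < 3)%N)) => //; left; split; last by rewrite /b1 /= [X in X < _]h2.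
    by split=> //; exact: pos.
  + exists (Ordinal (isT : (1 < 3)%N)) => //; right; split; last by rewrite /b2 /= [X in X < _]h1.
    by split=> //; exact: pos.
  + by exists ord_max => //; split; exact: pos.
- case: i => -[|[|[|//]]] lti.
  + by apply: (hty_homotopic _ (hD true true)) => z; exact: DV.
  + apply: (hty_homotopic _ hM) => z [] [/DV Dz bz]; first by left.
    by right.
  + by apply: (hty_homotopic _ (hD false false)) => z; exact: DV.
Qed.

End SmallComplexes.

(** * The lower model *)

Section LowerModel.
Variables (R : realType) (n : nat) (p : {set 'I_n} -> R) (mu : probability (subcomplex n) R).
Hypothesis mu_lower : is_lower_model p mu.

Lemma union_bound (I : eqType) (s : seq I) (A : I -> set (subcomplex n)) :
  (mu [set X | exists2 i, i \in s & A i X] <= \sum_(i <- s) mu (A i))%E.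
Proof.
elim: s => [|i s IH].
  rewrite big_nil (_ : [set X | _] = set0) ?measure0 //.
  by apply/seteqP; split=> X // [].
rewrite big_cons (_ : [set X | _] = A i `|` [set X | exists2 j, j \in s & A j X]).
  by apply: le_trans (measureU2 _ _ _) _ => //; apply: leeD.
apply/seteqP; split=> X /=.
  by move=> [j]; rewrite inE => /orP [/eqP -> ?|js ?]; [left|right; exists j].
by move=> [|[j js]] AX; [exists i|exists j] => //; rewrite inE ?eqxx ?js ?orbT.
Qed.

Lemma mu_contains (L : {set {set 'I_n}}) :
  face_closed L -> finset.set0 \notin L ->
  mu [set X : subcomplex n | (L \subset (X : {set {set 'I_n}}))%SET] =
  (\prod_(s in L) p s)%:E.
Proof.
move=> cL L0; have LP : is_subcomplex L.
  apply/forall_inP => s sL; apply/andP; split; first by apply: contraNneq L0 => <-.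
  by apply/forallP => t; apply/implyP => /andP [t0 ts]; exact: cL sL ts t0.
exact: (mu_lower (Subcomplex LP)).
Qed.

(** * Independence of the cones over a fixed subcomplex *)

Section Cones.
Variable G : {set {set 'I_n}}.
Hypothesis G0 : down_closed G.

Let Gs := (G :\ finset.set0)%SET.
Definition coneset (w : 'I_n) : {set {set 'I_n}} := [set (w |: g)%SET | g in G]%SET.
Let q (w : 'I_n) : R := \prod_(g in G) p (w |: g)%SET.
Let outside (w : 'I_n) := forall g, g \in G -> w \notin g.

Let complex_of (s : seq 'I_n) : {set {set 'I_n}} := foldr (fun w L => coneset w :|: L)%SET Gs s.

Lemma complex_of_closed s : face_closed (complex_of s).
Proof.
have [H0 HG] := G0.
have sG (s' : seq 'I_n) g : g \in G -> g != finset.set0 -> g \in complex_of s'.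
  by move=> gG g0; elim: s' => [|w s' IH] /=; rewrite !inE ?g0 ?gG ?IH ?orbT.
elim: s => [|w s IH] a b /=.
  by move=> /setD1P [b0 bG] ab a0; apply: (sG [::]) => //; exact: HG ab.
move=> /setUP [/imsetP [g gG ->]|bL] ab a0; last by rewrite inE (IH a b) ?orbT.
have [wa|wa] := boolP (w \in a).
  rewrite inE; apply/orP; left; apply/imsetP; exists (a :\ w)%SET.
    by apply: HG gG _; rewrite subDset.
  by rewrite finset.setD1K.
apply: (sG (w :: s)) => //; apply: HG gG _; apply/fintype.subsetP => x xa.
have := fintype.subsetP ab x xa; rewrite !inE => /orP [/eqP e|//].
by rewrite -e xa in wa.
Qed.

Lemma set0_complex_of s : finset.set0 \notin complex_of s.
Proof.
elim: s => [|w s IH] /=; first by rewrite !inE eqxx.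
rewrite inE negb_or IH andbT; apply/imsetP => -[g _ /finset.setP /(_ w)].
by rewrite !inE eqxx.
Qed.

(** Cones with distinct apexes outside [G] add disjoint sets of simplexes, so their contributions
    multiply. *)
Lemma prod_complex_of s : uniq s -> (forall w, w \in s -> outside w) ->
  \prod_(e in complex_of s) p e = (\prod_(e in Gs) p e) * \prod_(w <- s) q w.
Proof.
elim: s => [|w s IH] /=; first by rewrite big_nil mulr1.
move=> /andP [ws us] out; have ow : outside w by apply: out; rewrite mem_head.
rewrite (eq_bigl [predU coneset w & complex_of s]); last by move=> e; rewrite !inE.
rewrite bigU /=; last first.
  rewrite disjoint_subset; apply/fintype.subsetP => e /imsetP [g gG ->].
  have {IH us} : forall v, v \in s -> outside v by move=> v vs; apply: out; rewrite inE vs orbT.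
  rewrite inE; elim: s ws {out} => [|v s IH] /=.
    move=> _ _; rewrite !inE negb_and; apply/orP; right.
    by apply/negP => /ow; rewrite !inE eqxx.
  rewrite inE negb_or => /andP [wv ws] out; rewrite inE negb_or IH ?andbT //; last first.
    by move=> u us; apply: out; rewrite inE us orbT.
  apply/imsetP => -[g' g'G /finset.setP /(_ w)].
  by rewrite !inE eqxx (negPf wv) (negPf (ow _ g'G)).
rewrite IH //; last by move=> v vs; apply: out; rewrite inE vs orbT.
rewrite big_cons mulrCA; congr (_ * _); rewrite big_imset //= => g g' gG g'G /finset.setP e.
apply/finset.setP => x; have := e x; rewrite !inE; case: eqP => //= -> _.
by rewrite (negPf (ow _ gG)) (negPf (ow _ g'G)).
Qed.

Let event (s t : seq 'I_n) : set (subcomplex n) :=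
  [set X : subcomplex n | (complex_of s \subset (X : {set {set 'I_n}}))%SET /\
    forall w, w \in t -> ~~ (coneset w \subset (X : {set {set 'I_n}}))%SET].

(* Inclusion-exclusion, one vertex at a time. *)
Lemma mu_event s t : uniq (s ++ t) -> (forall w, w \in s ++ t -> outside w) ->
  mu (event s t) =
  ((\prod_(e in Gs) p e) * (\prod_(w <- s) q w) * \prod_(w <- t) (1 - q w))%:E.
Proof.
elim: t s => [|w t IH] s.
  rewrite cats0 => us out; rewrite big_nil mulr1 -prod_complex_of // -mu_contains.
  - by congr (mu _); apply/seteqP; split=> X [] // ? _.
  - exact: complex_of_closed.
  - exact: set0_complex_of.
move=> ust out.
have perm : perm_eq (s ++ w :: t) (w :: s ++ t) by rewrite perm_catC /= perm_cons perm_catC.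
have uwst : uniq ((w :: s) ++ t) by rewrite -(perm_uniq perm).
have ust' : uniq (s ++ t) by case/andP: uwst.
have out' v : v \in (w :: s) ++ t -> outside v by move=> vs; apply: out; rewrite (perm_mem perm).
have -> : event s (w :: t) = event s t `\` event (w :: s) t.
  apply/seteqP; split=> X /=.
    move=> [sX tX]; split; first by split=> // v vt; apply: tX; rewrite inE vt orbT.
    move=> [wsX _]; have := tX w; rewrite mem_head => /(_ isT) /negP; apply.
    by apply: fintype.subset_trans wsX; exact: finset.subsetUl.
  move=> [[sX tX] nX]; split=> // v; rewrite inE => /orP [/eqP ->|]; last exact: tX.
  by apply/negP => wX; apply: nX; split=> //=; rewrite finset.subUset wX.
rewrite measureD // ?(le_lt_trans (probability_le1 _ _)) ?ltry //.
have -> : event s t `&` event (w :: s) t = event (w :: s) t.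
  apply/seteqP; split=> X; first by case.
  move=> [wsX tX]; split; last by [].
  by split=> //; apply: fintype.subset_trans wsX; exact: finset.subsetUr.
have E1 : mu (event s t) = _ := IH s ust' _.
have E2 : mu (event (w :: s) t) = _ := IH (w :: s) uwst out'.
transitivity (mu (event s t) - mu (event (w :: s) t))%E; first by [].
rewrite E1 ?E2; last by move=> v vs; apply: out'; rewrite inE vs orbT.
by rewrite -EFinB; congr (_%:E); rewrite !big_cons; ring.
Qed.

(** All but at most [N] vertices lie outside [G]; given [G], they fail independently to cone it off,
    each with probability at most [1 - pmin ^+ N]. *)
Lemma mu_no_cone pmin N : 0 < pmin -> pmin <= 1 ->
  (forall s, s != finset.set0 -> pmin <= p s <= 1) -> (#|G| <= N)%N ->
  (mu [set X : subcomplex n | (Gs \subset (X : {set {set 'I_n}}))%SET /\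
         forall w, exists2 g, g \in G & (w |: g)%SET \notin (X : {set {set 'I_n}})]
   <= ((1 - pmin ^+ N) ^+ (n - N))%:E)%E.
Proof.
move=> p0 p1 pb GN; have [H0 HG] := G0.
pose t := [seq w <- enum 'I_n | [forall g in G, w \notin g]].
have tout w : w \in t -> outside w.
  by rewrite mem_filter => /andP [/forall_inP h _] g gG; exact: h.
have ut : uniq t by rewrite filter_uniq ?enum_uniq.
have szt : (n - N <= size t)%N.
  (* Each vertex of [G] gives a singleton in [G], so at most [N] vertices are lost. *)
  have : (size [seq w <- enum 'I_n | ~~ [forall g in G, w \notin g]] <= N)%N.
    rewrite -(size_map (fun w => [set w]%SET)) -(card_uniqP _); last first.
      by rewrite map_inj_uniq; [rewrite filter_uniq ?enum_uniq | exact: finset.set1_inj].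
    apply: leq_trans GN; apply: subset_leq_card; apply/fintype.subsetP => a /mapP [w].
    rewrite mem_filter negb_forall_in => /andP [/exists_inP [g gG]].
    by rewrite negbK => wg _ ->; apply: HG gG _; rewrite finset.sub1set.
  have := count_predC (fun w : 'I_n => [forall g in G, w \notin g]) (enum 'I_n).
  rewrite -!size_filter size_enum_ord -/t /= => sz h; rewrite leq_subLR.
  by rewrite -[leqLHS]sz addnC leq_add2r.
apply: le_trans (_ : mu (event [::] t) <= _)%E.
  apply: le_measure; rewrite ?inE //; move=> X [GX hX]; split=> //= w wt.
  have [g gG wg] := hX w; apply: contra wg => /fintype.subsetP; apply.
  exact: imset_f.
rewrite mu_event // lee_fin big_nil mulr1.
have pu s : s != finset.set0 -> 0 <= p s <= 1.
  by move=> /pb /andP [h ->]; rewrite (le_trans _ h) // ltW.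
have ne (w : 'I_n) (g : {set 'I_n}) : (w |: g)%SET != finset.set0.
  by apply/set0Pn; exists w; rewrite finset.setU11.
have ql w : pmin ^+ N <= q w.
  apply: (@le_trans _ _ (pmin ^+ #|G|)); first by rewrite ler_wiXn2l // ltW.
  rewrite -prodr_const; apply: ler_prod => g _; rewrite ltW //=.
  by case/andP: (pb _ (ne w g)).
have q1 w : q w <= 1.
  by apply: prodr_ile1 => g _; apply: pu.
have pN1 : 0 <= 1 - pmin ^+ N by rewrite subr_ge0 exprn_ile1 // ltW.
apply: (@le_trans _ _ (\prod_(w <- t) (1 - q w))).
  rewrite ler_piMl ?prodr_ge0 // => [w _|]; first by rewrite subr_ge0.
  by apply: prodr_ile1 => s /setD1P [s0 _]; apply: pu.
apply: (@le_trans _ _ (\prod_(w <- t) (1 - pmin ^+ N))).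
  by apply: ler_prod => w _; rewrite subr_ge0 q1 /= lerB.
rewrite big_const_seq count_predT iter_mulr_1; apply: ler_wiXn2l => //.
by rewrite gerBl exprn_ge0 // ltW.
Qed.

End Cones.

(** A face has at most [N] vertices, since their singletons lie in [G]; so [G] is encoded by an [N]
    by [N] table of vertices, padded with [None]. *)
Lemma card_down_closed N :
  (#|[set G : {set {set 'I_n}} | `[< down_closed G >] && (#|G| <= N)%N]%SET| <= n.+1 ^ (N * N))%N.
Proof.
pose row (phi : {ffun 'I_N * 'I_N -> option 'I_n}) i : {set 'I_n} :=
  [set v | [exists j, phi (i, j) == Some v]]%SET.
pose dec phi : {set {set 'I_n}} := (finset.set0 |: [set row phi i | i : 'I_N])%SET.
have -> : (n.+1 ^ (N * N) = #|[set: {ffun 'I_N * 'I_N -> option 'I_n}]%SET|)%N.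
  by rewrite cardsT card_ffun card_option card_prod !card_ord.
apply: leq_trans (leq_imset_card dec _); apply: subset_leq_card.
apply/fintype.subsetP => G; rewrite inE => /andP [/asboolP G0 GN]; have [H0 HG] := G0.
have gN g : g \in G -> (#|g| <= N)%N.
  move=> gG; apply: leq_trans GN.
  rewrite -(card_imset _ (@finset.set1_inj 'I_n)); apply: subset_leq_card.
  apply/fintype.subsetP => a /imsetP [w wg ->]; apply: HG gG _.
  by rewrite finset.sub1set.
pose phi := [ffun ij : 'I_N * 'I_N =>
  nth None (map Some (enum (nth finset.set0 (enum G) ij.1))) ij.2].
have rowE i : row phi i = nth finset.set0 (enum G) i.
  set g := nth _ _ _; have gG : g \in G.
    have [h|h] := ltnP i (size (enum G)); first by rewrite -mem_enum mem_nth.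
    by rewrite /g nth_default.
  apply/finset.setP => v; rewrite inE; apply/existsP/idP => [[j]|vg].
    rewrite ffunE /= -/g; have [h|h] := ltnP j (size (enum g)).
      by rewrite (nth_map v) // => /eqP [<-]; rewrite -mem_enum mem_nth.
    by rewrite nth_default // size_map.
  have vi : (index v (enum g) < N)%N.
    by apply: leq_trans (gN g gG); rewrite cardE index_mem mem_enum.
  exists (Ordinal vi); rewrite ffunE /= -/g (nth_map v) ?index_mem ?mem_enum //.
  by rewrite nth_index ?mem_enum.
apply/imsetP; exists phi => //; apply/finset.setP => g; rewrite inE.
apply/idP/orP => [gG|[/finset.set1P -> //|/imsetP [i _ ->]]].
  right; apply/imsetP.
  have gi : (index g (enum G) < N)%N.
    by apply: leq_trans GN; rewrite cardE index_mem mem_enum.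
  by exists (Ordinal gi) => //; rewrite rowE /= nth_index ?mem_enum.
rewrite rowE; have [h|h] := ltnP i (size (enum G)); first by rewrite -mem_enum mem_nth.
by rewrite nth_default.
Qed.

Variables (pmin pmax : R).
Hypotheses (pmin_gt0 : 0 < pmin) (pmax_lt1 : pmax < 1).
Hypothesis medial : forall s : {set 'I_n}, s != finset.set0 -> pmin <= p s <= pmax.
Hypothesis pmin_le_pmax : pmin <= pmax.

Lemma mu_not_conic N :
  (mu [set X : subcomplex n | ~ conic X N] <=
   ((n.+1 ^ (N * N))%:R * (1 - pmin ^+ N) ^+ (n - N))%:E)%E.
Proof.
have p1 : pmin <= 1 by rewrite (le_trans pmin_le_pmax) // ltW.
have pb s : s != finset.set0 -> pmin <= p s <= 1.
  by move=> /medial /andP [-> h]; rewrite (le_trans h) // ltW.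
pose Gs := [set G : {set {set 'I_n}} | `[< down_closed G >] && (#|G| <= N)%N]%SET.
pose bad (G : {set {set 'I_n}}) : set (subcomplex n) :=
  [set X : subcomplex n | (G :\ finset.set0 \subset (X : {set {set 'I_n}}))%SET /\
     forall w, exists2 g, g \in G & (w |: g)%SET \notin (X : {set {set 'I_n}})].
apply: (@le_trans _ _ (mu [set X | exists2 G, G \in enum Gs & bad G X])).
  apply: le_measure; rewrite ?inE // => X.
  rewrite /conic => /existsNP [G] /not_implyP [G0] /not_implyP [GX] /not_implyP [GN].
  move=> /forallNP hX; exists G; first by rewrite mem_enum inE asboolT.
  split=> // w; apply: contrapT => h; apply: (hX w) => g gG; apply: contrapT => wg.
  by apply: h; exists g => //; exact/negP.
apply: le_trans (union_bound _ _) _.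
rewrite big_enum /=.
apply: (@le_trans _ _ (\sum_(G in Gs) ((1 - pmin ^+ N) ^+ (n - N))%:E)%E).
  apply: lee_sum => G; rewrite inE => /andP [/asboolP G0 GN].
  exact: mu_no_cone.
rewrite sumEFin lee_fin sumr_const -[leLHS]mulr_natl; apply: ler_wpM2r.
  by rewrite exprn_ge0 // subr_ge0 exprn_ile1 // ltW.
by rewrite ler_nat card_down_closed.
Qed.

(** A face forces all its [2 ^ #|s| - 1] non-empty subsets, each contributing a factor at most
    [pmax]. *)
Lemma mu_face (s : {set 'I_n}) : s != finset.set0 ->
  (mu [set X : subcomplex n | s \in (X : {set {set 'I_n}})] <=
   (pmax ^+ (2 ^ #|s|).-1)%:E)%E.
Proof.
move=> s0; pose F := (powerset s :\ finset.set0)%SET.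
have FP t : (t \in F) = (t != finset.set0) && (t \subset s)%SET by rewrite !inE.
have -> : [set X : subcomplex n | s \in (X : {set {set 'I_n}})] =
          [set X : subcomplex n | (F \subset (X : {set {set 'I_n}}))%SET].
  apply/seteqP; split=> X /=.
    move=> sX; apply/fintype.subsetP => t; rewrite FP => /andP [t0 ts].
    exact: subcomplex_closed sX ts t0.
  by move=> /fintype.subsetP; apply; rewrite FP s0 /=.
rewrite mu_contains; last by rewrite FP eqxx.
  have -> : (2 ^ #|s|).-1 = #|F|.
    by rewrite -card_powerset (cardsD1 finset.set0 (powerset s)) inE finset.sub0set.
  rewrite lee_fin -prodr_const; apply: ler_prod => t; rewrite FP => /andP [t0 _].
  by have /andP [h ->] := medial t0; rewrite (le_trans _ h) // ltW.
move=> a b; rewrite !FP => /andP [_ bs] ab a0.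
by rewrite a0 (fintype.subset_trans ab).
Qed.

Lemma mu_large_face k : (0 < k)%N ->
  (mu [set X : subcomplex n | exists2 s : {set 'I_n}, #|s| = k & s \in (X : {set {set 'I_n}})] <=
   ((n ^ k)%:R * pmax ^+ (2 ^ k).-1)%:E)%E.
Proof.
move=> k0; pose Ss := [set s : {set 'I_n} | #|s| == k]%SET.
pose A (s : {set 'I_n}) := [set X : subcomplex n | s \in (X : {set {set 'I_n}})].
have pmax0 : 0 <= pmax by rewrite (le_trans _ pmin_le_pmax) // ltW.
apply: (@le_trans _ _ (mu [set X | exists2 s, s \in enum Ss & A s X])).
  apply: le_measure; rewrite ?inE // => X [s sk sX]; exists s => //.
  by rewrite mem_enum inE sk.
apply: le_trans (union_bound _ _) _; rewrite big_enum /=.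
apply: (@le_trans _ _ (\sum_(s in Ss) (pmax ^+ (2 ^ k).-1)%:E)%E).
  apply: lee_sum => s; rewrite inE => /eqP sk.
  by rewrite -sk; apply: mu_face; rewrite -card_gt0 sk.
rewrite sumEFin lee_fin sumr_const -[leLHS]mulr_natl; apply: ler_wpM2r.
  by rewrite exprn_ge0.
rewrite ler_nat card_draws card_ord.
apply: leq_trans (_ : n ^_ k <= _)%N; first by rewrite -bin_ffact leq_pmulr // fact_gt0.
rewrite ffact_prod -[k in leqRHS]card_ord -prod_nat_const.
by apply: leq_prod => i _; exact: leq_subr.
Qed.

End LowerModel.

(** * Asymptotics *)

Section Growth.
Local Open Scope nat_scope.

(** Equality holds at 16, and from there on [(x + 1) ^ 4 <= 2 * x ^ 4]. *)
Lemma expn4_le_exp2 x : 16 <= x -> x ^ 4 <= 2 ^ x.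
Proof.
elim: x => // x IH; rewrite leq_eqVlt => /orP [/eqP <- //|]; rewrite ltnS => hx.
rewrite [2 ^ _]expnS; apply: leq_trans (leq_mul (leqnn 2) (IH hx)).
have -> : x.+1 ^ 4 = x ^ 4 + 4 * x ^ 3 + 6 * x ^ 2 + 4 * x + 1.
  by rewrite !expnS !expn0; ring.
have : 16 * x ^ 3 <= x ^ 4 by rewrite [x ^ 4]expnS leq_mul2r hx orbT.
have : 16 * x ^ 2 <= x ^ 3 by rewrite [x ^ 3]expnS leq_mul2r hx orbT.
have : 16 * x <= x ^ 2 by rewrite -mulnn leq_mul2r hx orbT.
lia.
Qed.

Lemma cube_le_exp2 C x : 16 <= x -> C <= x -> C * x ^ 3 <= 2 ^ x.
Proof.
move=> hx hC; apply: leq_trans (expn4_le_exp2 hx).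
by rewrite [x ^ 4]expnS leq_mul2r hC orbT.
Qed.

(** Three exponents at a time: [3 ^ 3 * 2 = 54 <= 64 = 4 ^ 3]. *)
Lemma exp3_exp2_le_exp4 q : 3 ^ q * 2 ^ (q %/ 3) <= 4 ^ q.
Proof.
have mono x y k : x <= y -> x ^ k <= y ^ k.
  by move=> xy; elim: k => // k IH; rewrite !expnS leq_mul.
have split_exp a r : 3 ^ (3 * a + r) * 2 ^ a <= 4 ^ (3 * a + r).
  rewrite (expnD 3 (3 * a)) (expnD 4 (3 * a)) (expnM 3 3 a) (expnM 4 3 a).
  by rewrite mulnAC -expnMn; apply: leq_mul; exact: mono.
by have := split_exp (q %/ 3) (q %% 3); rewrite mulnC [3 * _]mulnC -divn_eq mulnC.
Qed.

Lemma exp4_dominates C : exists Q, forall q, Q <= q -> C * q.*2.+1 * 3 ^ q <= 4 ^ q.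
Proof.
(* With [a = q %/ 3] positive, [2 q + 1 <= 6 a + 5 <= 11 a]; the threshold makes [a] large enough
   for [cube_le_exp2]. *)
exists (3 * (16 + 11 * C)) => q hq; apply: leq_trans (exp3_exp2_le_exp4 q).
rewrite mulnC leq_mul2l; apply/orP; right; set a := q %/ 3.
have qa : q < 3 * a.+1 by rewrite mulnC ltn_ceil.
have ha : 16 + 11 * C <= a by rewrite leq_divRL // mulnC.
apply: leq_trans (cube_le_exp2 (C := 11 * C) (x := a) _ _); [|lia|lia].
have a3 : a <= a ^ 3 by rewrite !expnS expn0 muln1 leq_pmulr // muln_gt0; lia.
apply: (@leq_trans (11 * C * a)); last by rewrite leq_mul2l a3 orbT.
rewrite -mulnA mulnCA leq_mul2l; apply/orP; right; lia.
Qed.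

End Growth.

(** With [e = 2^-1 ^+ m], Bernoulli gives [(1 + e) ^+ (2 ^ m) >= 2], and [(1 - e) * (1 + e) <= 1]
    transfers this to [1 - e]. *)
Lemma geometric_half (R : realType) m j :
  (1 - (2 : R)^-1 ^+ m) ^+ (2 ^ m * j) <= 2^-1 ^+ j.
Proof.
set e : R := 2^-1 ^+ m; have e0 : 0 < e by rewrite exprn_gt0 // invr_gt0.
have e1 : e <= 1 by rewrite exprn_ile1 // ?invr_ge0 // invf_le1 // ler1n.
have d0 : 0 <= 1 - e by rewrite subr_ge0.
rewrite exprM; apply: lerXn2r; rewrite ?nnegrE ?exprn_ge0 ?invr_ge0 //.
have h2 : 2 <= (1 + e) ^+ (2 ^ m).
  have B (k : nat) : 1 + k%:R * e <= (1 + e) ^+ k.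
    elim: k => [|k IH]; first by rewrite mul0r addr0 expr0.
    rewrite exprS; apply: (@le_trans _ _ ((1 + e) * (1 + k%:R * e))).
      rewrite -natr1; have : 0 <= k%:R * e * e by rewrite !mulr_ge0 // ltW.
      lra.
    by rewrite ler_pM2l //; lra.
  apply: le_trans (B _); rewrite natrX /e -exprMn divff ?pnatr_eq0 // expr1n.
  by [].
have h1 : (1 - e) ^+ (2 ^ m) * (1 + e) ^+ (2 ^ m) <= 1.
  rewrite -exprMn; apply: exprn_ile1; last by nra.
  by rewrite mulr_ge0 //; lra.
have : (1 - e) ^+ (2 ^ m) * 2 <= 1.
  by apply: le_trans h1; rewrite ler_wpM2l // exprn_ge0.
by rewrite -ler_pdivlMr // mul1r.
Qed.

Section Asymptotics.
Variables (R : realType) (b e : nat) (pmin pmax : R).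
Hypotheses (b0 : (0 < b)%N) (e0 : (0 < e)%N).
Hypotheses (pminb : 2^-1 ^+ b <= pmin) (pmin1 : pmin <= 1).
Hypotheses (pmax0 : 0 <= pmax) (pmax1 : pmax <= 1) (pmaxe : pmax ^+ e <= 2^-1).

(** The largest [q] with [2 b 3 ^ q <= log_2 n]: then [2 ^ (b 3 ^ q)] is at most the square root of
    [n], while [log_2 n] remains of order [3 ^ q]. *)
Definition level (n : nat) : nat := trunc_log 3 (trunc_log 2 n %/ (2 * b)).

Lemma level_large Q : \forall n \near \oo, (Q <= level n)%N.
Proof.
near=> n; rewrite /level -[Q](trunc_expnK (p := 3)) //; apply: leq_trunc_log.
rewrite leq_divRL ?muln_gt0 ?b0 // -[X in (X <= _)%N](trunc_expnK (p := 2)) //.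
by apply: leq_trunc_log; near: n; exact: nbhs_infty_ge.
Unshelve. all: by end_near. Qed.

Let half_ge0 : (0 : R) <= 2^-1. Proof. by rewrite invr_ge0. Qed.
Let half_le1 : (2^-1 : R) <= 1. Proof. by rewrite invf_le1 // ler1n. Qed.

Lemma pow2_half (i j k : nat) : (i + k <= j)%N ->
  ((2 ^ i)%N%:R : R) * 2^-1 ^+ j <= 2^-1 ^+ k.
Proof.
move=> h; apply: (@le_trans _ _ ((2 ^ i)%N%:R * 2^-1 ^+ (i + k))).
  by apply: ler_wpM2l => //; apply: ler_wiXn2l.
by rewrite exprD mulrA natrX -exprMn divff ?pnatr_eq0 // expr1n mul1r.
Qed.

Lemma failure_bounds : \forall n \near \oo, let q := level n in
  [/\ (0 < q)%N,
      (n ^ q.*2.+1)%:R * pmax ^+ (2 ^ q.*2.+1).-1 <= 2^-1 ^+ q &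
      (n.+1 ^ (3 ^ q * 3 ^ q))%:R * (1 - pmin ^+ (3 ^ q)) ^+ (n - 3 ^ q) <= 2^-1 ^+ q].
Proof.
(* The bound on large faces needs [e * (M.+1 * k + q) <= 4 ^ q]; here [M.+1 <= 6 * b * N] and
   [q <= k * N] produce the constant. *)
have [Q1 HQ1] := exp4_dominates (e * (6 * b + 1)).
near=> n; rewrite /=.
have hQ1 : (Q1 <= level n)%N by near: n; exact: level_large.
have hQ2 : (16 + (6 * b + 2) <= level n)%N by near: n; exact: level_large.
have n0 : (0 < n)%N by near: n; exact: nbhs_infty_ge.
set q := level n in hQ1 hQ2 *.
set N := (3 ^ q)%N; set M := trunc_log 2 n.
have q0 : (0 < q)%N by lia.
have Mb : (0 < M %/ (2 * b))%N.
  by move: q0; rewrite /q /level -/M; case: (M %/ (2 * b))%N => //; rewrite trunc_log0.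
have MN : (2 * b * N <= M)%N.
  by rewrite mulnC -leq_divRL ?muln_gt0 ?b0 //; exact: trunc_logP.
have NM : (M < 6 * b * N)%N.
  have := trunc_log_ltn (p := 3) (M %/ (2 * b)) isT.
  rewrite ltn_divLR ?muln_gt0 ?b0 // expnS -/q -/N; congr (_ < _)%N; lia.
have nM : (n < 2 ^ M.+1)%N by exact: trunc_log_ltn.
have Mn : (2 ^ M <= n)%N by exact: trunc_logP.
have qN : (q < N)%N by exact: ltn_expl.
have N1 : (0 < N)%N by lia.
set k := q.*2.+1.
have mono (x y i : nat) : (x <= y -> x ^ i <= y ^ i)%N.
  by move=> xy; elim: i => // i IH; rewrite !expnS leq_mul.
have hMk (k' : nat) : (M.+1 * k' <= 6 * b * N * k')%N by rewrite leq_mul2r NM orbT.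
split=> //.
  have k4 : (4 ^ q <= (2 ^ k).-1)%N.
    have -> : (2 ^ k = 2 * 4 ^ q)%N by rewrite expnS -muln2 (mulnC q) (expnM 2 2).
    have : (0 < 4 ^ q)%N by rewrite expn_gt0.
    by lia.
  set j := (M.+1 * k + q)%N.
  have ej : (e * j <= 4 ^ q)%N.
    apply: leq_trans (HQ1 q hQ1); rewrite -/N -/k -!mulnA leq_mul2l; apply/orP; right.
    have := hMk k; rewrite /j; have : (q <= k * N)%N by rewrite /k; nia.
    by rewrite mulnDl mul1n -!mulnA (mulnC N k); lia.
  apply: (@le_trans _ _ ((2 ^ (M.+1 * k))%N%:R * 2^-1 ^+ j)); last by apply: pow2_half.
  apply: ler_pM => //; first by rewrite exprn_ge0.
    by rewrite ler_nat expnM mono // ltnW.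
  apply: (@le_trans _ _ (pmax ^+ (e * j))).
    by apply: ler_wiXn2l => //; exact: leq_trans k4.
  by rewrite exprM; apply: lerXn2r; rewrite ?nnegrE ?exprn_ge0.
(* There are at most [2 ^ (M.+1 * (N * N))] candidates, so each may fail with probability
   [2^-1 ^+ j]; by [geometric_half] this takes [2 ^ (b * N) * j] trials. *)
set j := (M.+1 * (N * N) + q)%N.
have jb : (j.+1 <= 2 ^ (b * N))%N.
  apply: (@leq_trans (2 ^ N)%N); last by rewrite leq_exp2l // leq_pmull.
  apply: leq_trans (cube_le_exp2 (C := 6 * b + 2) (x := N) _ _); [|lia|lia].
  have := hMk (N * N)%N; rewrite /j; have : (N <= N * N * N)%N by nia.
  have -> : (N ^ 3 = N * N * N)%N by rewrite !expnS expn0 muln1 mulnA.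
  rewrite -!mulnA => h1 h2; rewrite mulnDl; lia.
(* Since [2 b N <= M], [n] has room for two factors [2 ^ (b * N)]: one per halving, one bounding
   [j.+1]. *)
have jn : (2 ^ (b * N) * j <= n - N)%N.
  have h1 : (2 ^ (b * N) * 2 ^ (b * N) <= n)%N.
    by rewrite -expnD; apply: leq_trans Mn; rewrite leq_exp2l //; lia.
  have h2 : (N <= 2 ^ (b * N))%N 
    by apply: leq_trans (leq_pmull N b0) _; exact: ltnW (ltn_expl _ _).
  have h3 : (2 ^ (b * N) * j.+1 <= 2 ^ (b * N) * 2 ^ (b * N))%N by rewrite leq_mul2l jb orbT.
  by rewrite mulnS in h3; lia.
have pN : 2^-1 ^+ (b * N) <= pmin ^+ N.
  by rewrite exprM; apply: lerXn2r; rewrite ?nnegrE ?exprn_ge0 // (le_trans _ pminb) ?exprn_ge0.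
apply: (@le_trans _ _ ((2 ^ (M.+1 * (N * N)))%N%:R * 2^-1 ^+ j)); last by apply: pow2_half.
have pmin0 : 0 <= pmin by rewrite (le_trans _ pminb) ?exprn_ge0.
have pN1 : pmin ^+ N <= 1 by rewrite exprn_ile1.
apply: ler_pM => //; first by rewrite exprn_ge0 // subr_ge0.
  by rewrite ler_nat (expnM 2 M.+1) mono.
apply: le_trans (geometric_half R (b * N) j).
apply: (@le_trans _ _ ((1 - 2^-1 ^+ (b * N)) ^+ (n - N))).
  by apply: lerXn2r; rewrite ?nnegrE ?subr_ge0 ?exprn_ile1 // lerB.
by apply: ler_wiXn2l => //; rewrite ?subr_ge0 ?exprn_ile1 // gerBl exprn_ge0.
Unshelve. all: by end_near. Qed.

End Asymptotics.

(** Excluding faces with exactly [2 q + 1] vertices is enough, since any larger face contains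
    one. *)
Lemma TC_le2 (R : realType) (n : nat) (X : subcomplex n) q :
  (0 < q)%N -> conic X (3 ^ q) ->
  ~ (exists2 s : {set 'I_n}, #|s| = q.*2.+1 & s \in (X : {set {set 'I_n}})) ->
  (TC R (realisation R X) <= 2%:E)%E.
Proof.
move=> q0 coneX sizeX; apply: ereal_inf_lbound; exists 2%N => //.
apply: conic_TC_cover coneX _ => // s sX; rewrite leqNgt; apply/negP => hs.
apply: sizeX; have : (0 < 'C(#|s|, q.*2.+1))%N by rewrite bin_gt0.
rewrite -cards_draws => /card_gt0P [t]; rewrite inE => /andP [ts /eqP tq].
exists t => //; apply: subcomplex_closed sX ts _.
by rewrite -card_gt0 tq.
Qed.

Theorem theorem16 (R : realType) (pmin pmax : R)
    (p : forall n : nat, {set 'I_n} -> R)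
    (mu : forall n : nat, probability (subcomplex n) R)
    (pmin_gt0 : 0 < pmin) (pmin_le_pmax : pmin <= pmax) (pmax_lt1 : pmax < 1)
    (medial : forall (n : nat) (s : {set 'I_n}),
       s != finset.set0 -> pmin <= p n s <= pmax)
    (mu_lower : forall n : nat, is_lower_model (p n) (mu n)) :
  (fun n : nat => mu n [set X : subcomplex n | (TC R (realisation R X) <= 2%:E)%E])
    @ \oo --> 1%E.
Proof.
have half0 : (0 : R) < 2^-1 by lra.
have half1 : (2^-1 : R) < 1 by lra.
have half01 : 0 <= (2^-1 : R) < 1 by apply/andP; split; first exact: ltW.
have pmax01 : 0 <= pmax < 1.
  by rewrite (le_trans _ pmin_le_pmax) // ltW.
have pow_small (r eps : R) : 0 <= r < 1 -> 0 < eps -> exists2 k, (0 < k)%N & r ^+ k <= eps.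
  move=> /andP [r0 r1] eps0.
  have r_cvg : (fun k => r ^+ k) @ \oo --> (0 : R) by apply: cvg_expr; rewrite ger0_norm.
  near \oo => k; exists k; first by near: k; exact: nbhs_infty_gt.
  by apply: ltW; near: k; exact: (cvgr_lt _ r_cvg).
have [pmax0 _] := andP pmax01.
(* The constants [b] and [e] depend only on [pmin] and [pmax], so the estimates are uniform in the
   parameters [p n]. *)
have [b b0 pminb] := pow_small 2^-1 pmin half01 pmin_gt0.
have [e e0 pmaxe] := pow_small pmax 2^-1 pmax01 half0.
have pmin1 : pmin <= 1 by rewrite (le_trans pmin_le_pmax) // ltW.
have bounds := failure_bounds b0 e0 pminb pmin1 pmax0 (ltW pmax_lt1) pmaxe.
apply/fine_cvgP; split.
  by near=> n; rewrite fin_num_measure.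
apply/cvgrPdist_le => eps eps0; have eps2 : 0 < eps / 2 by rewrite divr_gt0.
have [Q Q0 hQ] := pow_small 2^-1 (eps / 2) half01 eps2.
near=> n.
have [q0 bnd1 bnd2] : [/\ (0 < level b n)%N,
      (n ^ (level b n).*2.+1)%:R * pmax ^+ (2 ^ (level b n).*2.+1).-1 <= 2^-1 ^+ level b n &
      (n.+1 ^ (3 ^ level b n * 3 ^ level b n))%:R *
        (1 - pmin ^+ (3 ^ level b n)) ^+ (n - 3 ^ level b n) <= 2^-1 ^+ level b n].
  by near: n; exact: bounds.
have Qq : (Q <= level b n)%N by near: n; exact: level_large.
set q := level b n in q0 bnd1 bnd2 Qq.
rewrite /=; set good := [set X : subcomplex n | _].
(* If the bound on [TC] fails, [X] has a face with [2 q + 1] vertices or is not conic; each event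
   has probability at most [2^-1 ^+ q <= eps / 2]. *)
have badE : (mu n (~` good) <= eps%:E)%E.
  pose A := [set X : subcomplex n | exists2 s : {set 'I_n},
    #|s| = q.*2.+1 & s \in (X : {set {set 'I_n}})].
  pose B := [set X : subcomplex n | ~ conic X (3 ^ q)].
  apply: (@le_trans _ _ (mu n (A `|` B))).
    apply: le_measure; rewrite ?inE // => X nX; apply: contrapT => /not_orP [nA nB].
    by apply: nX; exact: (TC_le2 R q0 (contrapT nB) nA).
  apply: (@le_trans _ _ (mu n A + mu n B)%E); first exact: measureU2.
  have hA := mu_large_face (mu_lower n) pmin_gt0 (medial n) pmin_le_pmax (k := q.*2.+1) isT.
  have hB := mu_not_conic (mu_lower n) pmin_gt0 pmax_lt1 (medial n) pmin_le_pmax (3 ^ q).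
  apply: le_trans (leeD hA hB) _; rewrite -EFinD lee_fin.
  apply: le_trans (lerD bnd1 bnd2) _.
  have : 2^-1 ^+ q <= eps / 2.
    apply: le_trans hQ; by apply: ler_wiXn2l => //; exact: ltW.
  lra.
have goodfin : mu n good \is a fin_num by rewrite fin_num_measure.
have := badE; rewrite probability_setC // -(fineK goodfin) -EFinB lee_fin => h.
rewrite ger0_norm // subr_ge0 -lee_fin fineK //; exact: probability_le1.
Unshelve. all: by end_near. Qed.
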